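(* Let $G \in \mathcal{E}$ with vertex $3$-partition $\{V_1, V_2, V_3\}$, and suppose that $G[B_{1} \cup B_{3}] \cup G[B_{2} \cup B_{3}] \in \mathcal{H}$. Let $vw$ be any edge of $G$ with $v \in B_{3}$. If $w \in V_1$, then it is possible to partition the vertex set of $G$ into two disjoint subsets $S$, $T$ so that each of them induces a tree in $G$, $B_{1} \subseteq S$, $B_{2} \subseteq T$, and $v, w \in S$. If $w \in V_2$, then it is possible to partition the vertex set of $G$ into two disjoint subsets $S$, $T$ so that each of them induces a tree in $G$, $B_{1} \subseteq S$, $B_{2} \subseteq T$, and $v, w \in T$.
   Context: All graphs are finite and simple. $\mathcal{E}$ is the family of all simple even plane triangulations with at least four vertices, where even means that every vertex has even degree. Such a graph $G$ has a vertex $3$-partition $\{V_1,V_2,V_3\}$, i.e. a partition of $V(G)$ into three independent sets. A vertex $v$ is big in $G$ if $d_G(v) \geq 6$; $B_i$ denotes the set of all big vertices in $V_i$, $i=1,2,3$. For $U \subseteq V(G)$, $G[U]$ is the subgraph of $G$ induced by $U$; the union of two subgraphs has as vertex set (edge set) the union of their vertex sets (edge sets). $\mathcal{H}$ is the family of all graphs in which every cycle has length congruent to $0$ modulo $4$. *)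

(* Defs.v *)
(* Finite simple graphs, plane triangulations as combinatorial maps, and the
   families of graphs used in the theorem (MathComp). *)
From mathcomp Require Import all_boot all_fingroup.

Set Implicit Arguments.
Unset Strict Implicit.
Unset Printing Implicit Defensive.

(* The vertex set is a subset of the carrier X, so that subgraphs of a graph
   are graphs over the same carrier. Edges are two-element sets of vertices:
   no loops, no parallel edges. *)
Record graph (X : finType) := Graph {
  verts : {set X};
  edges : {set {set X}};
  graph_wf : [forall e in edges, (e \subset verts) && (#|e| == 2)]
}.

Section Graphs.
Variable X : finType.
Implicit Types (G H : graph X) (U A B : {set X}).

Definition adj G : rel X := fun x y => [set x; y] \in edges G.

Lemma adj_sym G : symmetric (adj G).
Proof. by move=> x y; rewrite /adj setUC. Qed.

Definition deg G (x : X) : nat := #|[set y | adj G x y]|.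

Lemma induced_wf G U :
  [forall e in [set e in edges G | e \subset U],
     (e \subset verts G :&: U) && (#|e| == 2)].
Proof.
apply/forall_inP => e; rewrite inE => /andP[eG eU].
by have /andP[eV ->] := forall_inP (graph_wf G) _ eG; rewrite subsetI eV eU.
Qed.

Definition induced G U : graph X := Graph (induced_wf G U).

Lemma gunion_wf G H :
  [forall e in edges G :|: edges H,
     (e \subset verts G :|: verts H) && (#|e| == 2)].
Proof.
apply/forall_inP => e /setUP[] eE.
- have /andP[eV ->] := forall_inP (graph_wf G) _ eE.
  by rewrite (subset_trans eV (subsetUl _ _)).
- have /andP[eV ->] := forall_inP (graph_wf H) _ eE.
  by rewrite (subset_trans eV (subsetUr _ _)).
Qed.

Definition gunion G H : graph X := Graph (gunion_wf G H).

Definition graph_cycle G (c : seq X) : bool :=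
  [&& 2 < size c, uniq c & path.cycle (adj G) c].

Definition connected_graph G : Prop :=
  verts G != set0 /\ {in verts G &, forall x y, connect (adj G) x y}.

Definition is_tree G : Prop :=
  connected_graph G /\ forall c, ~~ graph_cycle G c.

Definition independent G U : Prop := {in U &, forall x y, ~~ adj G x y}.

Definition vertex_3partition G (V1 V2 V3 : {set X}) : Prop :=
  [/\ uniq [:: V1; V2; V3], partition [set V1; V2; V3] (verts G),
      independent G V1, independent G V2 & independent G V3].

Definition big_in G U : {set X} := [set x in U | 6 <= deg G x].

Definition cycles_0mod4 G : Prop :=
  forall c, graph_cycle G c -> size c = 0 %[mod 4].

Definition tree_bipartition G A B : Prop :=
  [/\ A :|: B = verts G, [disjoint A & B],
      is_tree (induced G A) & is_tree (induced G B)].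

(* Embeddings in the oriented sphere (equivalently, in the plane, the unbounded
   face not being distinguished) are represented by rotation systems. A dart
   (x, y) is the edge xy oriented from x to y. *)
Definition dart G := {d : X * X | adj G d.1 d.2}.

Definition dart_rev G (d : dart G) : dart G :=
  exist _ ((val d).2, (val d).1) (etrans (adj_sym G _ _) (valP d)).

Lemma dart_rev_inj G : injective (@dart_rev G).
Proof.
apply: (@can_inj _ _ _ (@dart_rev G)) => d; apply: val_inj.
by rewrite /= -surjective_pairing.
Qed.

(* The cycles of s are the cyclic orders of the darts leaving each vertex. *)
Definition rotation_system G (s : {perm dart G}) : Prop :=
  forall d d' : dart G, (d' \in porbit s d) = ((val d').1 == (val d).1).

(* Follow (x, y) by the dart s (y, x) leaving y: the cycles of this permutation
   are the boundary walks of the faces. *)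
Definition face_perm G (s : {perm dart G}) : {perm dart G} :=
  (perm (@dart_rev_inj G) * s)%g.

(* The last clause is Euler's formula, i.e. genus 0. *)
Definition plane_embedding G (s : {perm dart G}) : Prop :=
  [/\ connected_graph G, rotation_system s &
      #|verts G| + #|porbits (face_perm s)| = #|edges G| + 2].

(* As G has no loops, a face walk of length 3 traverses a triangle. *)
Definition plane_triangulation G (s : {perm dart G}) : Prop :=
  plane_embedding s /\ forall d, #|porbit (face_perm s) d| = 3.

Definition even_plane_triangulation G (s : {perm dart G}) : Prop :=
  [/\ plane_triangulation s, 4 <= #|verts G| &
      {in verts G, forall x, ~~ odd (deg G x)}].

End Graphs.

(* Main.v *)
(* Let H be the bipartite graph of the edges of G between B3 and B1 :|: B2.
   If B3 splits as C :|: C' so that B1 :|: C and B2 :|: C' induce forests, these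
   two sets grow to complementary induced forests S and T of G.  First every
   vertex of degree 4 in V1 goes to S unless its two V3-neighbours both lie in
   C, and symmetrically for V2; each is a leaf.  Every remaining vertex u has
   degree 4 and two opposite neighbours on the same side, and can be added
   greedily: if both choices closed a cycle, a path of S and a path of T joining
   the two pairs of opposite neighbours of u would cross.  As every face has
   exactly one edge inside S or T, Euler's formula then forces the forests to be
   trees.

   To split B3, vertices of B3 with at most one neighbour in B1 (or in B2) are
   removed first, being harmless in C (or C').  In a depth-first search tree of
   the rest, take an end block: every vertex of B3 in it has degree at least 3,
   and colouring by depth / 2 modulo 2 leaves no monochromatic cycle, because the
   lengths 0 modulo 4 restrict how back edges can nest.

   When w has degree 4 its second V3-neighbour q matters only if q is big; then
   v and q have two common neighbours in H, and w can be treated as a vertex of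
   B1 as long as v and q are not already joined in S. *)
Require Import Defs.
From mathcomp Require Import all_boot all_fingroup all_algebra zify.

Set Implicit Arguments.
Unset Strict Implicit.
Unset Printing Implicit Defensive.

(** * Acyclic vertex sets *)

(** The colour depth / 2 modulo 2 comes from parity: H is bipartite, so the vertices of B3 in one
    search tree have depths of one parity and equal colours mean equal depths modulo 4, whereas a
    back edge climbs 3 levels modulo 4. Two back edges that start at or below a vertex u in separate
    branches and end strictly above u close a cycle through u, whose length forces one of them to
    start at an odd distance below u. The restrictions on nesting follow from this parity rule. The
    obstacle is that the side of v is prescribed. It cannot be removed when it has few neighbours,
    so its degree is not under control; the search is rooted at v whenever v has an edge to offer,
    which keeps v out of the subtree to be coloured. When w has degree 4, cycles through w escape
    the hypothesis; searches run without w, and its effect is checked afterwards. That two paths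
    must cross is linear algebra over ['F_2]: in genus 0 a rank count shows that each closed walk
    bounds a set of faces, and passing from one side of the walk to the other becomes a matter of
    parity. *)

Section Acyclic.
Variables (X : finType) (e : rel X).
Hypotheses (e_sym : symmetric e) (e_irr : irreflexive e).
Implicit Types (A B K : {set X}) (x y u : X).

Definition nbrs B x : {set X} := [set y in B | e x y].

(** A finite graph has a cycle exactly if some nonempty vertex set induces minimum degree at least
    2. In this form the notion is hereditary and provides leaves for inductions, without any cycle
    being written as a sequence. *)
Definition acyclic_on A : Prop :=
  forall B, B \subset A -> {in B, forall x, 1 < #|nbrs B x|} -> B = set0.

Definition rel_on A : rel X := fun x y => [&& x \in A, y \in A & e x y].

Lemma nbrsS A B x : A \subset B -> nbrs A x \subset nbrs B x.
Proof.
move=> /subsetP sAB; apply/subsetP => y; rewrite !inE => /andP[yA ->].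
by rewrite sAB.
Qed.

Lemma acyclic_onS A B : A \subset B -> acyclic_on B -> acyclic_on A.
Proof. by move=> sAB acB K sKA; apply: acB; apply: subset_trans sAB. Qed.

Lemma acyclic_on_leaf A B :
  acyclic_on A -> B \subset A -> B != set0 ->
  exists2 x, x \in B & #|nbrs B x| <= 1.
Proof.
move=> acA sBA B0; apply/exists_inP; apply: contraNT B0 => noleaf.
apply/eqP/(acA B) => // x xB; rewrite ltnNge; apply: contra noleaf => leaf.
by apply/exists_inP; exists x.
Qed.

Lemma rel_on_sym A : symmetric (rel_on A).
Proof. by move=> x y; rewrite /rel_on e_sym andbCA. Qed.

(** A nontrivial tree has two leaves, so [a] cannot be the only one. Deleting [a] makes its
    neighbour the only vertex that may be a leaf, and the induction goes on. *)
Lemma acyclic_on_root A K a :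
  acyclic_on A -> K \subset A -> a \in K ->
  {in K, forall x, x != a -> 1 < #|nbrs K x|} -> K = [set a].
Proof.
move=> acA; have [n] := ubnP #|K|; elim: n K a => // n IHn K a ltKn sKA aK degK.
apply/eqP; apply: contraT => Ka.
have K0 : K != set0 by apply/set0Pn; exists a.
have [x xK leafx] := acyclic_on_leaf acA sKA K0.
have eax : x = a.
  by apply: contraTeq leafx => xa; rewrite -ltnNge degK.
subst x; clear xK.
(* If [a] is isolated in [K], any other vertex serves as [b]. *)
have [b bK' nbra] : exists2 b, b \in K :\ a & nbrs K a \subset [set b].
  have [nbr0 | [b bK]] := set_0Vmem (nbrs K a).
    have : K :\ a != set0.
      apply: contra Ka => /eqP E; rewrite eqEsubset sub1set aK andbT.
      by rewrite -setD_eq0 E.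
    by case/set0Pn => b bK; exists b; rewrite // nbr0 sub0set.
  exists b.
    move: bK; rewrite !inE => /andP[-> eab]; rewrite andbT.
    by apply: contraTneq eab => ->; rewrite e_irr.
  apply/subsetP => y yK; rewrite inE; apply: contraTT leafx => yb.
  rewrite -ltnNge; apply: leq_trans (subset_leq_card (_ : [set b; y] \subset _)).
    by rewrite cards2 eq_sym yb.
  by apply/subsetP => z /set2P[]->.
have nbrK' x : x \in K :\ a -> x != b -> nbrs (K :\ a) x = nbrs K x.
  rewrite !inE => /andP[xa xK] xb; apply/setP => y; rewrite !inE.
  have [-> | //] := eqVneq y a; rewrite aK /=; symmetry.
  apply: contraNF xb => exa; rewrite -in_set1; apply: (subsetP nbra).
  by rewrite inE xK e_sym.
have K'E : K :\ a = [set b].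
  apply: IHn bK' _.
  - by rewrite (cardsD1 a) aK in ltKn.
  - exact: subset_trans (subsetDl _ _) sKA.
  - move=> x xK' xb; rewrite nbrK' //; move: xK'; rewrite !inE => /andP[xa xK].
    exact: degK.
have /andP[ba bK] : (b != a) && (b \in K) by move: bK'; rewrite !inE.
have := degK b bK ba; rewrite ltnNge => /negP[].
rewrite -(cards1 a) subset_leq_card //; apply/subsetP => y.
rewrite !inE => /andP[yK eby]; apply: contraT => ya.
have : y \in K :\ a by rewrite !inE ya.
by rewrite K'E inE => /eqP yb; rewrite yb e_irr in eby.
Qed.

(** Let [B] have minimum degree 2 and contain [u], and let [K] be the component of [B :\ u] at a
    neighbour [a] of [u]. By separation [a] is the only neighbour of [u] in [K], so [K] reduces to
    [a], which is then a leaf of [B]. *)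
Lemma acyclic_on_add A u :
  acyclic_on A -> u \notin A ->
  {in A &, forall a b, e u a -> e u b -> a != b -> ~~ connect (rel_on A) a b} ->
  acyclic_on (u |: A).
Proof.
move=> acA uA sep B sBA degB.
have [uB | uB] := boolP (u \in B); last first.
  apply: (acA) => //; apply/subsetP => x xB.
  have := subsetP sBA x xB; rewrite !inE => /orP[/eqP xu | //].
  by rewrite -xu xB in uB.
have sB'A : B :\ u \subset A by rewrite subDset.
have [a aN] : exists a, a \in nbrs B u.
  by apply/set0Pn; rewrite -card_gt0; apply: ltn_trans (degB u uB).
have /andP[aB eua] : (a \in B) && e u a by rewrite inE in aN.
have aB' : a \in B :\ u.
  by rewrite !inE aB andbT; apply: contraTneq eua => ->; rewrite e_irr.
pose K := [set x in B :\ u | connect (rel_on (B :\ u)) a x].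
have sKB : K \subset B :\ u by apply/subsetP => x; rewrite inE => /andP[].
have nbrK x y : x \in K -> y \in B -> y != u -> e x y -> y \in K.
  move=> xK yB yu exy; have xB' := subsetP sKB x xK.
  have yB' : y \in B :\ u by rewrite !inE yu yB.
  rewrite inE yB' /=; move: xK; rewrite inE => /andP[_ /connect_trans]; apply.
  by apply: connect1; rewrite /rel_on xB' yB'.
have aK : a \in K by rewrite inE aB' connect0.
have KE : K = [set a].
  apply: (acyclic_on_root acA _ aK) => [|x xK xa].
    exact: subset_trans sB'A.
  have xB' := subsetP sKB x xK.
  have xB : x \in B by move: xB'; rewrite !inE => /andP[].
  apply: leq_trans (degB x xB) _; apply: subset_leq_card; apply/subsetP => y.
  rewrite inE => /andP[yB exy]; rewrite inE exy andbT.
  suff yu : y != u by apply: nbrK exy.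
  apply: contraTneq exy => ->; rewrite e_sym.
  apply/negP => eux; have /negP[] : ~~ connect (rel_on A) a x.
    by apply: sep; rewrite ?(subsetP sB'A) // eq_sym.
  move: xK; rewrite inE => /andP[_]; apply: connect_sub => y1 y2.
  move=> /and3P[y1B y2B e12]; apply: connect1.
  by rewrite /rel_on e12 !(subsetP sB'A).
have := degB a aB; rewrite ltnNge => /negP[].
rewrite -(cards1 u) subset_leq_card //; apply/subsetP => y.
rewrite !inE => /andP[yB eay]; apply: contraT => yu.
have := nbrK a y aK yB yu eay; rewrite KE inE => /eqP ya.
by rewrite ya e_irr in eay.
Qed.

Lemma nbrsD1 A x y : x \in A ->
  #|nbrs A y| = e y x + #|nbrs (A :\ x) y|.
Proof.
move=> xA; rewrite (cardsD1 x) inE xA /=; congr (_ + #|pred_of_set _|).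
by apply/setP => z; rewrite !inE andbA.
Qed.

Lemma sum_nbrsD1 A x : x \in A ->
  \sum_(y in A) #|nbrs A y| =
    2 * #|nbrs A x| + \sum_(y in A :\ x) #|nbrs (A :\ x) y|.
Proof.
move=> xA; rewrite (big_setD1 x xA) /=.
under eq_bigr => y _ do rewrite (nbrsD1 _ xA).
rewrite big_split /= addnA; congr (_ + _).
rewrite mul2n -addnn; congr (_ + _).
rewrite (nbrsD1 _ xA) e_irr -sum1_card [RHS]big_mkcond /= big_mkcond /=.
by apply: eq_bigr => y _; rewrite !inE e_sym; case: (y == x); case: (y \in A); case: (e x y).
Qed.

(** A leaf takes at most one edge with it, hence at most [#|A| - 1] edges, each counted twice in the
    sum; equality means that every removed leaf had a neighbour. The equality case is what turns
    forests into trees later. *)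
Lemma acyclic_on_count A : acyclic_on A -> A != set0 ->
  \sum_(x in A) #|nbrs A x| + 2 <= 2 * #|A| /\
  (\sum_(x in A) #|nbrs A x| + 2 = 2 * #|A| ->
     {in A &, forall x y, connect (rel_on A) x y}).
Proof.
have [n] := ubnP #|A|; elim: n A => // n IHn A ltAn acA A0.
have [x xA leafx] := acyclic_on_leaf acA (subxx A) A0.
have sA'A : A :\ x \subset A by apply: subsetDl.
have cardA : #|A| = #|A :\ x|.+1 by rewrite (cardsD1 x) xA.
rewrite (sum_nbrsD1 xA) cardA.
have [A'0 | A'0] := eqVneq (A :\ x) set0.
  have nbrx0 : nbrs A x = set0.
    apply/setP => y; rewrite !inE; apply/negP => /andP[yA exy].
    have : y \in A :\ x.
      by rewrite !inE yA andbT; apply: contraTneq exy => ->; rewrite e_irr.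
    by rewrite A'0 inE.
  rewrite nbrx0 A'0 !cards0 big_set0; split=> // _ y z yA zA.
  suff ex t : t \in A -> t = x by rewrite (ex y yA) (ex z zA) connect0.
  by move=> tA; apply/eqP; have := in_set0 t; rewrite -A'0 !inE tA andbT => /negbFE.
have [|le conn] := IHn _ _ (acyclic_onS sA'A acA) A'0.
  by rewrite cardA in ltAn.
split=> [|E]; first lia.
have connA' : {in A :\ x &, forall y z, connect (rel_on A) y z}.
  move=> y z yA zA; apply: connect_sub (conn _ y z yA zA); last lia.
  move=> t t' /and3P[tA t'A ett]; apply: connect1.
  by rewrite /rel_on ett !(subsetP sA'A).
have [y yN] : exists y, y \in nbrs A x.
  by apply/set0Pn; rewrite -card_gt0; lia.
have /andP[yA exy] : (y \in A) && e x y by rewrite inE in yN.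
have yA' : y \in A :\ x.
  by rewrite !inE yA andbT; apply: contraTneq exy => ->; rewrite e_irr.
have conny z : z \in A -> connect (rel_on A) y z.
  move=> zA; have [-> | zx] := eqVneq z x; last by apply: connA'; rewrite // !inE zx.
  by apply: connect1; rewrite /rel_on yA xA e_sym.
move=> z t zA tA; apply: connect_trans (conny t tA).
by rewrite (sym_connect_sym (rel_on_sym A)) ; apply: conny.
Qed.

Lemma acyclic_on_cycle A c :
  acyclic_on A -> {subset c <= A} -> uniq c -> path.cycle e c -> size c <= 2.
Proof.
move=> acA scA Uc cyc; rewrite leqNgt; apply/negP => lt2c.
have c0 : [set x in c] = set0.
  apply: acA => [|x]; first by apply/subsetP => x; rewrite inE; apply: scA.
  rewrite inE => xc.
  have nx := next_cycle cyc xc; have px := prev_cycle cyc xc.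
  apply: leq_trans (subset_leq_card (_ : [set next c x; prev c x] \subset _)).
    suff nxp : next c x != prev c x by rewrite cards2 nxp.
    apply: contraTneq lt2c => E; have Enn : next c (next c x) = x.
      by rewrite E next_prev.
    have [i p defp] := rot_to xc.
    move: Enn (Uc); rewrite -!(next_rot i Uc) -(rot_uniq i) -(size_rot i) defp.
    case: p {defp} => [|y [|z p]] //=; rewrite !eqxx => zx.
    case: (eqVneq x y) zx => [->|yx]; first by rewrite !inE eqxx.
    by move=> ->; rewrite !inE eqxx orbT.
  apply/subsetP => y /set2P[]->; rewrite !inE ?mem_next ?mem_prev xc //=.
  by rewrite e_sym.
by case: c lt2c c0 {scA Uc cyc} => // x c _ /setP/(_ x); rewrite !inE eqxx.
Qed.

End Acyclic.

(** * Depth-first search trees *)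

(* A depth-first search tree of the component W of r in h[U], [tp x] being the
   tree path from r to x. *)
Record normal_tree (X : finType) (h : rel X) (U : {set X}) (r : X)
    (W : {set X}) (tp : X -> seq X) : Prop := NormalTree {
  nt_root : r \in W;
  nt_sub : W \subset U;
  nt_path : forall x, x \in W ->
    exists p, [/\ tp x = r :: p, path h r p, last r p = x & uniq (r :: p)];
  nt_prefix : forall x y, x \in W -> y \in tp x ->
    y \in W /\ prefix (tp y) (tp x);
  nt_comparable : forall x y, x \in W -> y \in W -> h x y ->
    (x \in tp y) || (y \in tp x);
  nt_closed : forall x y, x \in W -> y \in U -> h x y -> y \in W
}.

(** The search exhausts the component [W1] of [y] in [U :\ r], then resumes from [r] outside [W1];
    both calls are instances of the induction hypothesis. Edges leaving [W1] inside [U] end in [r],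
    an ancestor of every vertex, so comparability is preserved. *)
Lemma normal_tree_exists (X : finType) (h : rel X) (U : {set X}) (r : X) :
  symmetric h -> r \in U -> exists W tp, normal_tree h U r W tp.
Proof.
move=> h_sym; have [n] := ubnP #|U|; elim: n U r => // n IHn U r ltUn rU.
have ltU1 : #|U :\ r| < n by rewrite (cardsD1 r) rU in ltUn.
have [y /andP[yU hry] | no_nbr] := pickP [pred y | (y \in U :\ r) && h r y];
  last first.
  exists [set r], (fun=> [:: r]); split.
  - by rewrite inE.
  - by rewrite sub1set.
  - by move=> x /set1P ->; exists [::].
  - by move=> x y _; rewrite !inE => /eqP ->; rewrite eqxx prefix_refl.
  - by move=> x y /set1P -> /set1P ->; rewrite inE eqxx.
  - move=> x y /set1P -> yU hry; rewrite inE.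
    by have /negbT := no_nbr y; rewrite /= !inE yU hry !andbT negbK.
have [W1 [t1 N1]] := IHn _ y ltU1 yU.
have sW1 := subsetP (nt_sub N1).
have rW1 : r \notin W1 by apply/negP => /sW1; rewrite !inE eqxx.
have rU2 : r \in U :\: W1 by rewrite inE rW1.
have ltU2 : #|U :\: W1| < n.
  rewrite -ltnS; apply: leq_trans ltUn; rewrite ltnS; apply: proper_card.
  rewrite properE subsetDl; apply/subsetPn; exists y.
    by move: yU; rewrite !inE => /andP[].
  by rewrite !inE (nt_root N1).
have [W2 [t2 N2]] := IHn _ r ltU2 rU2.
have sW2 := subsetP (nt_sub N2).
have disj x : x \in W2 -> x \in W1 = false.
  by move/sW2; rewrite inE => /andP[/negbTE].
have t2r : t2 r = [:: r].
  have [p [-> _ Ep /= /andP[rp _]]] := nt_path N2 (nt_root N2).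
  by case: p Ep rp => //= a p <-; rewrite mem_last.
have sep a b : a \in W1 -> b \in W2 -> h a b -> b = r.
  move=> aW bW hab; apply/eqP; apply: contraFT (disj b bW) => br.
  apply: nt_closed N1 _ _ aW _ hab; have := sW2 b bW.
  by rewrite !inE br => /andP[].
exists (W1 :|: W2), (fun x => if x \in W1 then r :: t1 x else t2 x); split.
- by rewrite inE (nt_root N2) orbT.
- by rewrite subUset (subset_trans (nt_sub N1)) ?subsetDl //
    (subset_trans (nt_sub N2)) // subsetDl.
- move=> x /setUP[xW | xW]; last by rewrite (disj x xW); apply: nt_path N2 _ xW.
  have [p [t1x ph lp Up]] := nt_path N1 xW.
  rewrite xW t1x; exists (y :: p); split=> //=; first by rewrite hry.
  rewrite -[_ && uniq _]/(uniq (y :: p)) Up andbT -t1x.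
  by apply: contra rW1 => /(nt_prefix N1 xW)[].
- move=> x z /setUP[xW | xW].
    rewrite xW inE => /predU1P[-> | /(nt_prefix N1 xW)[zW pz]].
      by rewrite inE (nt_root N2) orbT (negbTE rW1) t2r /= eqxx prefix0s.
    by rewrite inE zW /= eqxx.
  rewrite (disj x xW) => /(nt_prefix N2 xW)[zW pz].
  by rewrite inE zW orbT (disj z zW).
- move=> a b /setUP[aW | aW] /setUP[bW | bW] hab.
  + by rewrite aW bW !inE; case/orP: (nt_comparable N1 aW bW hab) => ->;
      rewrite !orbT.
  + by rewrite aW (sep a b) // inE eqxx orbT.
  + by rewrite bW (sep b a) // ?inE ?eqxx // h_sym.
  + by rewrite (disj a aW) (disj b bW); exact: (nt_comparable N2 aW bW hab).
- move=> a b /setUP[aW | aW] bU hab; rewrite inE.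
    have [-> | br] := eqVneq b r; first by rewrite (nt_root N2) orbT.
    by rewrite (nt_closed N1 aW _ hab) // !inE br.
  have [//| bW1] := boolP (b \in W1).
  by rewrite (nt_closed N2 aW _ hab) // inE bW1.
Qed.

(** * Ancestors and tree paths *)

Section NormalTree.
Variables (X : finType) (h : rel X) (U : {set X}) (r : X).
Variables (W : {set X}) (tp : X -> seq X).
Hypotheses (h_sym : symmetric h) (N : normal_tree h U r W tp).
Implicit Types (a b c u w x y z : X).

Definition depth x := size (tp x).

(** For an ancestor [a] of [b], the tree path from [a] to [b] with [a] left out and [b] included. *)
Definition seg a b := drop (depth a) (tp b).

Lemma tp_self x : x \in W -> x \in tp x.
Proof. by case/(nt_path N) => p [-> _ <- _]; apply: mem_last. Qed.

Lemma tp_sub x y : x \in W -> y \in tp x -> y \in W.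
Proof. by move=> xW /(nt_prefix N xW)[]. Qed.

Lemma tp_uniq x : x \in W -> uniq (tp x).
Proof. by case/(nt_path N) => p [->]. Qed.

Lemma tp_last x : x \in W -> last r (tp x) = x.
Proof. by case/(nt_path N) => p [->]. Qed.

Lemma tp_root x : x \in W -> r \in tp x.
Proof. by case/(nt_path N) => p [->]; rewrite inE eqxx. Qed.

Lemma tp_trans a b c : c \in W -> b \in tp c -> a \in tp b -> a \in tp c.
Proof.
move=> cW /(nt_prefix N cW)[_ /prefixP[s ->]] ab.
by rewrite mem_cat ab.
Qed.

Lemma prefix_comparable (s1 s2 s : seq X) :
  prefix s1 s -> prefix s2 s -> size s1 <= size s2 -> prefix s1 s2.
Proof.
by rewrite !prefixE => E1 /eqP E2 le; rewrite -E2 take_takel.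
Qed.

Lemma tp_le_depth a b c : c \in W -> a \in tp c -> b \in tp c ->
  (a \in tp b) = (depth a <= depth b).
Proof.
move=> cW ac bc; have [[aW pa] [bW pb]] := (nt_prefix N cW ac, nt_prefix N cW bc).
apply/idP/idP => [ab | le].
  by have [_] := nt_prefix N bW ab; apply: size_prefix.
have /prefixP[s ->] : prefix (tp a) (tp b) by apply: (prefix_comparable pa pb le).
by rewrite mem_cat tp_self.
Qed.

Lemma tp_depth a b : b \in W -> a \in tp b -> depth a <= depth b.
Proof. by move=> bW ab; rewrite -(tp_le_depth bW) ?tp_self. Qed.

Lemma tp_depth_inj a b c : c \in W -> a \in tp c -> b \in tp c ->
  depth a = depth b -> a = b.
Proof.
move=> cW ac bc E; have [[aW pa] [bW pb]] := (nt_prefix N cW ac, nt_prefix N cW bc).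
have pab : prefix (tp a) (tp b).
  by apply: (prefix_comparable pa pb); rewrite -/(depth a) E.
suff Eab : tp a = tp b by rewrite -(tp_last aW) Eab tp_last.
by move: pab; rewrite prefixE -/(depth a) E take_size => /eqP.
Qed.

Lemma tp_lt_depth a b : b \in W -> a \in tp b -> a != b -> depth a < depth b.
Proof.
move=> bW ab; rewrite ltn_neqAle (tp_depth bW ab) andbT; apply: contra => /eqP E.
by apply/eqP; apply: (tp_depth_inj bW); rewrite ?tp_self.
Qed.

Lemma tp_cat a b : b \in W -> a \in tp b -> tp b = tp a ++ seg a b.
Proof.
move=> bW ab; have [_ /prefixP[s E]] := nt_prefix N bW ab.
by rewrite /seg E drop_size_cat.
Qed.

Lemma mem_seg a b c : b \in W -> a \in tp b ->
  (c \in seg a b) = (c \in tp b) && (depth a < depth c).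
Proof.
move=> bW ab; have aW := tp_sub bW ab.
have Ub := tp_uniq bW; rewrite (tp_cat bW ab) cat_uniq in Ub.
case/and3P: Ub => _ /hasPn disj _.
apply/idP/andP => [cs | [cb lt]].
  have cb : c \in tp b by rewrite (tp_cat bW ab) mem_cat cs orbT.
  split=> //; rewrite ltnNge -(tp_le_depth bW) //.
  by apply: contra (disj _ cs).
move: cb; rewrite {1}(tp_cat bW ab) mem_cat => /orP[ca | //].
by have := tp_depth aW ca; rewrite leqNgt lt.
Qed.

Lemma seg_path a b : b \in W -> a \in tp b ->
  [/\ path h a (seg a b), last a (seg a b) = b, uniq (seg a b) &
      size (seg a b) = depth b - depth a].
Proof.
move=> bW ab; have aW := tp_sub bW ab; have E := tp_cat bW ab.
have [p [tb ph lp Up]] := nt_path N bW; have [q [ta qh lq Uq]] := nt_path N aW.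
have Ep : p = q ++ seg a b by move: E; rewrite tb ta => -[].
split.
- by move: ph; rewrite {1}Ep cat_path lq => /andP[].
- by rewrite -[RHS]lp Ep last_cat lq.
- by rewrite /seg drop_uniq // tp_uniq.
- by rewrite size_drop.
Qed.

Lemma tp_child a b : b \in W -> a \in tp b -> a != b ->
  exists2 c, c \in tp b & [/\ a \in tp c, depth c = (depth a).+1 & h a c].
Proof.
move=> bW ab nab; have aW := tp_sub bW ab.
have [ph lp Up sp] := seg_path bW ab.
have lt := tp_lt_depth bW ab nab.
case Es: (seg a b) ph lp sp => [|c s] /=; first by move=> _ _; lia.
case/andP=> hac _ _ _.
have cs : c \in seg a b by rewrite Es inE eqxx.
have /andP[cb ltc] : (c \in tp b) && (depth a < depth c) by rewrite -mem_seg.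
have cW := tp_sub bW cb.
exists c => //; have ac : a \in tp c by rewrite (tp_le_depth bW) // ltnW.
split=> //; have [_ lac _ sac] := seg_path cW ac.
suff: size (seg a c) <= 1 by rewrite sac; lia.
have : tp b = tp c ++ seg c b by apply: tp_cat.
rewrite (tp_cat cW ac) {1}(tp_cat bW ab) Es -catA => /eqP.
rewrite eqseq_cat // eqxx /= => /eqP.
case Eac: (seg a c) lac => [|c' s'] /= lac.
  by move=> _; lia.
move=> [Ec _]; case: s' lac Eac => // d s' lac Eac.
have [_ _ ] := seg_path cW ac; rewrite Eac -Ec /= => /andP[cnot _] _.
by rewrite -lac -Ec /= mem_last in cnot.
Qed.

End NormalTree.

(** * Graphs whose cycles have length 0 modulo 4 *)

Section TreeMod4.
Variables (X : finType) (h : rel X) (P U : {set X}) (r : X).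
Variables (W : {set X}) (tp : X -> seq X).
Hypotheses (h_sym : symmetric h) (N : normal_tree h U r W tp).
Hypothesis h_bip : forall x y, h x y -> (x \in P) != (y \in P).
Hypothesis cyc4 : forall s, {subset s <= U} -> uniq s -> path.cycle h s ->
  2 < size s -> 4 %| size s.
Implicit Types (a b c p u w x y z : X).

Local Notation depth := (depth tp).
Local Notation seg := (seg tp).

(** The gap of at least two levels excludes the tree edge from [w] to its parent. *)
Definition back w b := [&& h w b, b \in tp w & (depth b).+1 < depth w].

Lemma bip_irr : irreflexive h.
Proof. by move=> x; apply/negP => /h_bip; rewrite eqxx. Qed.

Lemma path_parity x s : path h x s ->
  (x \in P) (+) (last x s \in P) = odd (size s).
Proof.
elim: s x => [|y s IHs] x /=; first by rewrite addbb.
case/andP => /h_bip xy /IHs <-; move: xy.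
by case: (x \in P); case: (y \in P); case: (last y s \in P).
Qed.

Lemma depth_parity a b : b \in W -> a \in tp b ->
  (a \in P) (+) (b \in P) = odd (depth b - depth a).
Proof.
by move=> bW ab; have [ph l _ <-] := seg_path N bW ab; rewrite -(path_parity ph) l.
Qed.

(** Vertices on the same side have depths of equal parity; the parity of half the depth is the
    remaining bit modulo 4. *)
Lemma depth_half_mod4 a b : a \in W -> b \in W -> (a \in P) = (b \in P) ->
  odd (depth a)./2 = odd (depth b)./2 -> depth a = depth b %[mod 4].
Proof.
move=> aW bW ab; have := depth_parity aW (tp_root N aW).
have := depth_parity bW (tp_root N bW); rewrite ab => ->.
have := tp_depth N aW (tp_root N aW); have := tp_depth N bW (tp_root N bW).
move: (depth r) (depth a) (depth b) => n k l.
move=> nl nk; rewrite !oddB // => E Eh.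
have {}E : odd k = odd l by case: (odd n) (odd k) (odd l) E => [] [] [].
have dec m : m = m./2./2 * 4 + (odd m + (odd m./2).*2).
  by rewrite -[LHS]odd_double_half -{1}[m./2]odd_double_half; clear; lia.
by rewrite (dec k) (dec l) !modnMDl E Eh.
Qed.

(** The cycle descends in the tree from [b2] to [b1], takes the edge to [w1], climbs to [u],
    descends to [w2] and returns by the edge to [b2]. The last hypothesis excludes the degenerate
    walk back and forth along one edge. *)
Lemma tree_cycle u w1 w2 b1 b2 :
  w1 \in W -> w2 \in W -> u \in tp w1 -> u \in tp w2 ->
  ~~ has [in seg u w1] (seg u w2) ->
  b1 \in tp u -> b1 != u -> b2 \in tp b1 -> h w1 b1 -> h w2 b2 ->
  (w1 != w2) || (b1 != b2) ->
  4 %| (depth b1 - depth b2) + (depth w1 - depth u) + (depth w2 - depth u) + 2.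
Proof.
move=> w1W w2W uw1 uw2 disj b1u nb1u b2b1 h1 h2 ne.
have uW := tp_sub N w1W uw1; have b1W := tp_sub N uW b1u.
have lt1 := tp_lt_depth N uW b1u nb1u.
have [ph1 l1 U1 s1] := seg_path N w1W uw1.
have [ph2 l2 U2 s2] := seg_path N w2W uw2.
have [phb lb Ub sb] := seg_path N b1W b2b1.
pose s := (b2 :: seg b2 b1) ++ (rev (seg u w1) ++ u :: seg u w2).
have sz : size s = (depth b1 - depth b2) + (depth w1 - depth u)
                   + (depth w2 - depth u) + 2.
  by rewrite !size_cat /= size_rev s1 s2 sb; clear; lia.
rewrite -sz; apply: cyc4.
- move=> y; rewrite !mem_cat !(mem_rev, inE) => H.
  apply: (subsetP (nt_sub N)).
  case/or4P: H => [/predU1P[-> | ys]|ys|/eqP-> //|ys].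
  + exact: (tp_sub N b1W b2b1).
  + by move: ys; rewrite (mem_seg N) // => /andP[/(tp_sub N b1W)].
  + by move: ys; rewrite (mem_seg N) // => /andP[/(tp_sub N w1W)].
  + by move: ys; rewrite (mem_seg N) // => /andP[/(tp_sub N w2W)].
- have b2W := tp_sub N b1W b2b1.
  rewrite cat_uniq cons_uniq Ub andbT.
  rewrite (mem_seg N) // ltnn andbF /= cat_uniq rev_uniq U1 cons_uniq U2.
  rewrite !(mem_seg N) // ltnn andbF /= !andbT.
  apply/andP; split; last first.
    rewrite negb_or mem_rev (mem_seg N) // ltnn andbF /=.
    by under eq_has => y do rewrite /= mem_rev.
  apply/hasPn => y; rewrite mem_cat mem_rev inE => H.
  have ltuy : depth u <= depth y.
    case/or3P: H => [|/eqP-> //|]; rewrite (mem_seg N) //.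
      by case/andP => _ /ltnW.
    by case/andP => _ /ltnW.
  apply/negP; rewrite inE => /orP[/eqP yb2|].
    by have := tp_depth N b1W b2b1; rewrite -yb2; move: lt1 ltuy; clear; lia.
  by rewrite (mem_seg N) // => /andP[/(tp_depth N b1W)]; move: lt1 ltuy; clear; lia.
- rewrite /s /= rcons_cat cat_path phb lb /= -cats1 -catA cat_cons.
  rewrite -cat1s catA cats1 -rev_cons lastI l1 rev_rcons /= h_sym h1 /=.
  rewrite cat_path cat_path /= -{1}l1 rev_path.
  rewrite (eq_path (e' := h)); last by move=> y y'; apply: h_sym.
  rewrite ph1 /=.
  have -> : last w1 (rev (belast u (seg u w1))) = u.
    have -> : last w1 (rev (belast u (seg u w1))) =
              last w1 (rev (u :: seg u w1)) by rewrite lastI l1 rev_rcons.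
    by rewrite rev_cons last_rcons.
  by rewrite ph2 l2 h2.
- rewrite sz; case/orP: ne => [ne|ne]; last first.
    by have := tp_lt_depth N b1W b2b1; rewrite eq_sym ne => /(_ isT); clear; lia.
  have : (depth u < depth w1) || (depth u < depth w2).
    have [E1|n1] := eqVneq u w1; last by rewrite (tp_lt_depth N).
    by rewrite (tp_lt_depth N _ uw2) ?orbT // E1.
  by clear; lia.
Qed.

(** The cycle closed by the back edge has [depth w - depth b + 1] vertices. *)
Lemma back_depth w b : w \in W -> back w b -> depth w = depth b + 3 %[mod 4].
Proof.
move=> wW /and3P[hwb bw lt].
have [ph l Us s] := seg_path N wW bw.
have : 4 %| size (b :: seg b w).
  apply: cyc4.
  - move=> y; rewrite inE => /orP[/eqP->|].
      by apply: (subsetP (nt_sub N)); apply: (tp_sub N wW bw).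
    rewrite (mem_seg N) // => /andP[yw _].
    by apply: (subsetP (nt_sub N)); apply: (tp_sub N wW yw).
  - by rewrite /= Us andbT (mem_seg N) // ltnn andbF.
  - by rewrite /= rcons_path ph l.
  - by rewrite /= s; move: lt; clear; lia.
by rewrite /= s; move: lt; clear; lia.
Qed.

(* The cycle through u, w1, b1, b2, w2 has length 2 (depth w1 - depth u) + 2
   modulo 4. *)
Lemma back_odd u w1 w2 b1 b2 :
  w1 \in W -> w2 \in W -> u \in tp w1 -> u \in tp w2 ->
  ~~ has [in seg u w1] (seg u w2) ->
  b1 \in tp u -> b1 != u -> b2 \in tp u -> back w1 b1 -> back w2 b2 ->
  (w1 != w2) || (b1 != b2) -> depth b2 <= depth b1 ->
  odd (depth w1 - depth u).
Proof.
move=> w1W w2W uw1 uw2 disj b1u nb1u b2u back1 back2 ne le.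
have uW := tp_sub N w1W uw1.
have b21 : b2 \in tp b1 by rewrite (tp_le_depth N uW).
have [/and3P[h1 _ _] /and3P[h2 _ _]] := (back1, back2).
have := tree_cycle w1W w2W uw1 uw2 disj b1u nb1u b21 h1 h2 ne.
have := back_depth w1W back1; have := back_depth w2W back2.
have := tp_depth N w1W uw1; have := tp_depth N w2W uw2.
move: le; clear; lia.
Qed.

Lemma seg_self u : seg u u = [::].
Proof. exact: drop_size. Qed.

Lemma back_odd_or u w1 w2 b1 b2 :
  w1 \in W -> w2 \in W -> u \in tp w1 -> u \in tp w2 ->
  ~~ has [in seg u w1] (seg u w2) ->
  b1 \in tp u -> b1 != u -> b2 \in tp u -> b2 != u ->
  back w1 b1 -> back w2 b2 -> (w1 != w2) || (b1 != b2) ->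
  odd (depth w1 - depth u) || odd (depth w2 - depth u).
Proof.
move=> w1W w2W uw1 uw2 disj b1u nb1u b2u nb2u back1 back2 ne.
have [le|/ltnW le] := leqP (depth b2) (depth b1).
  by rewrite (back_odd w1W w2W uw1 uw2 disj b1u nb1u b2u).
rewrite orbC (back_odd w2W w1W uw2 uw1 _ b2u nb2u b1u) //.
  by rewrite has_sym.
by rewrite eq_sym [b2 == _]eq_sym.
Qed.

(** Two back edges of [w] would both start at distance 0 from [u = w], against the parity rule
    [back_odd_or]. *)
Lemma back_uniq w a b : w \in W -> back w a -> back w b -> a = b.
Proof.
move=> wW backa backb; apply/eqP; apply: contraT => ne.
have tpw := tp_self N wW; have [/and3P[_ aw la] /and3P[_ bw lb]] := (backa, backb).
have ne_lt x : (depth x).+1 < depth w -> x != w by apply: contraTneq => ->; clear; lia.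
have := back_odd_or wW wW tpw tpw _ aw (ne_lt _ la) bw (ne_lt _ lb) backa backb.
by rewrite seg_self // ne orbT subnn /= => /(_ isT isT).
Qed.

Lemma neighbour_below x y : x \in W -> y \in tp x -> h x y ->
  (depth x == (depth y).+1) || back x y.
Proof.
move=> xW yx hxy; rewrite /back hxy yx /=.
have : y != x by apply: contraTneq hxy => ->; rewrite bip_irr.
by move/(tp_lt_depth N xW yx); clear; lia.
Qed.

End TreeMod4.

(** * End blocks of the search tree *)

Section EndBlock.
Variables (X : finType) (h : rel X) (P U : {set X}) (r : X).
Variables (W : {set X}) (tp : X -> seq X).
Hypotheses (h_sym : symmetric h) (N : normal_tree h U r W tp).
Hypothesis h_bip : forall x y, h x y -> (x \in P) != (y \in P).
Hypothesis cyc4 : forall s, {subset s <= U} -> uniq s -> path.cycle h s ->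
  2 < size s -> 4 %| size s.
Implicit Types (a b c p u w x y z : X).

Local Notation depth := (depth tp).
Local Notation seg := (seg tp).
Local Notation back := (back h tp).

Definition child z c := (z \in tp c) && (depth c == (depth z).+1).

(** The lowpoint test for cut vertices: some edge leads from the subtree at [c] past [z] to a proper
    ancestor of [z]. *)
Definition escapes z c :=
  [exists w, exists b, [&& w \in W, c \in tp w, h w b, b \in tp z & b != z]].

(* z separates the subtree at c from the rest of the graph, and no vertex of
   that subtree is a separator of the same kind. *)
Definition end_block z c := [/\ c \in W, child z c, ~~ escapes z c &
  forall u d, c \in tp u -> d \in W -> child u d -> escapes u d].

(** The subtree at a child of the root does not escape, the root having no proper ancestor; among
    all pairs that do not escape, a deepest one is an end block. *)
Lemma end_block_exists c0 : c0 \in W -> c0 != r -> exists z c, end_block z c.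
Proof.
move=> c0W c0r.
have rc0 := tp_root N c0W.
have [c1 c1c0 [rc1 dc1 _]] : exists2 c, c \in tp c0 &
    [/\ r \in tp c, depth c = (depth r).+1 & h r c].
  by apply: (tp_child N c0W rc0); rewrite eq_sym.
have c1W := tp_sub N c0W c1c0.
pose good (e : X * X) := [&& e.2 \in W, child e.1 e.2 & ~~ escapes e.1 e.2].
have good1 : good (r, c1).
  rewrite /good /child /= c1W rc1 dc1 eqxx /=.
  apply/existsPn => w; apply/existsPn => b; apply/negP.
  case/and5P => wW _ _ br /negP[]; apply/eqP.
  have [p [tpr _ lp Up]] := nt_path N (nt_root N).
  move: br Up; rewrite tpr; case: p lp {tpr} => [|y p] /= lp.
    by rewrite inE => /eqP.
  by rewrite -{2}lp mem_last.
have [[z c] /= /and3P[/= cW zc nesc] max] := arg_maxnP (fun e => depth e.2) good1.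
exists z, c; split=> // u d cu dW ud; apply: contraT => nescu.
have := max (u, d); rewrite /good /= dW ud nescu => /(_ isT).
have /andP[ud1 /eqP ->] := ud; have uW := tp_sub N dW ud1.
by have := tp_depth N uW cu; rewrite ltnNge => ->.
Qed.

Variables z c : X.
Hypothesis block : end_block z c.

Definition subtree : {set X} := [set w in W | c \in tp w].
Local Notation D := subtree.

Lemma block_cW : c \in W. Proof. by case: block. Qed.
Lemma block_zc : z \in tp c. Proof. by case: block => _ /andP[]. Qed.
Lemma block_depth : depth c = (depth z).+1.
Proof. by case: block => _ /andP[_ /eqP]. Qed.
Lemma block_zW : z \in W. Proof. exact: (tp_sub N block_cW block_zc). Qed.

Lemma subtreeW x : x \in D -> x \in W. Proof. by rewrite inE => /andP[]. Qed.

Lemma subtree_up x y : x \in D -> y \in W -> x \in tp y -> y \in D.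
Proof.
rewrite !inE => /andP[xW cx] yW xy; rewrite yW.
exact: (tp_trans N yW xy cx).
Qed.

Lemma mem_c_subtree : c \in D.
Proof. by rewrite inE block_cW (tp_self N block_cW). Qed.

Lemma subtree_depth x : x \in D -> depth z < depth x.
Proof.
by rewrite inE => /andP[xW cx]; rewrite -block_depth (tp_depth N).
Qed.

Lemma root_notin_subtree : r \notin D.
Proof.
apply/negP => rD; have rW := subtreeW rD.
have := subtree_depth rD; rewrite ltnNge (tp_depth N) ?(tp_root N) //;
  exact: block_zW.
Qed.

Lemma subtree_nbr x y : x \in D -> y \in U -> h x y -> y \in z |: D.
Proof.
move=> xD yU hxy; have xW := subtreeW xD; have yW := nt_closed N xW yU hxy.
rewrite in_setU1; case/orP: (nt_comparable N xW yW hxy) => [xy | yx].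
  by rewrite (subtree_up xD yW xy) orbT.
have cx : c \in tp x by move: xD; rewrite inE => /andP[].
have zx : z \in tp x := tp_trans N xW cx block_zc.
have [le | lt] := leqP (depth c) (depth y).
  by rewrite inE yW (tp_le_depth N xW) // le orbT.
have [-> // | yz] := eqVneq y z.
case: block => _ _ /existsPn/(_ x)/existsPn/(_ y)/negP[].
rewrite xW cx hxy yz andbT /= (tp_le_depth N xW) //.
by rewrite block_depth ltnS in lt.
Qed.

Hypothesis deg3 : {in D, forall p, p \in P -> 2 < #|nbrs h U p|}.

(** Besides its parent [x] and the end of its only back edge, [p] has a third neighbour, which lies
    below it; the subtree at the child of [p] in that direction sends an edge past [p]. The parity
    rule at [p], applied to that edge and the back edge of [p] itself, puts [w] at odd distance from
    [p], hence at even distance from [x]. *)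
Lemma subtree_escape x p y : x \in D -> p \in D -> p \in P -> child x p ->
  back p y -> exists w b, [/\ w \in W /\ p \in tp w, back w b, b \in tp x, b != x &
    ~~ odd (depth w - depth x)].
Proof.
move=> xD pD pP xp bpy; have /andP[xtp /eqP dp] := xp.
have pW := subtreeW pD; have xW := subtreeW xD.
have /and3P[hpy ytp ltpy] := bpy.
have [y3 y3N y3ne] : exists2 y3, y3 \in nbrs h U p & y3 \notin [set x; y].
  apply/subsetPn; apply: contraL (deg3 pD pP) => /subset_leq_card le.
  by rewrite -leqNgt (leq_trans le) // cards2; case: eqP.
have /andP[y3U hp3] : (y3 \in U) && h p y3 by rewrite inE in y3N.
move: y3ne; rewrite !inE negb_or => /andP[y3x y3y].
have y3W := nt_closed N pW y3U hp3.
have py3 : p \in tp y3.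
  case/orP: (nt_comparable N pW y3W hp3) => // y3p.
  case/orP: (neighbour_below N h_bip pW y3p hp3) => [/eqP E|b3].
    case/negP: y3x; apply/eqP; apply: (tp_depth_inj N pW) => //.
    by move: E; rewrite dp => -[].
  by case/negP: y3y; rewrite (back_uniq h_sym N cyc4 pW b3 bpy).
have npy3 : p != y3 by apply: contraTneq hp3 => ->; rewrite (bip_irr h_bip).
have [d dy3 [pd dd _]] := tp_child N y3W py3 npy3.
have dW := tp_sub N y3W dy3.
have [_ _ _ esc] := block.
have cp : c \in tp p by move: pD; rewrite inE => /andP[].
have /existsP[w /existsP[b]] : escapes p d.
  by apply: esc; rewrite // /child pd dd eqxx.
case/and5P=> wW dw hwb btp nbp.
have pw : p \in tp w := tp_trans N wW dw pd.
have ltb := tp_lt_depth N pW btp nbp.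
have ltw := tp_depth N wW dw.
have bw : back w b.
  by rewrite /back hwb (tp_trans N wW pw btp); move: ltb ltw; rewrite dd; clear; lia.
have nyp : y != p by apply: contraTneq ltpy => ->; clear; lia.
have ptp := tp_self N pW.
have nwp : w != p by apply: contraTneq ltw => ->; rewrite dd ltnn.
have := back_odd_or h_sym N cyc4 wW pW pw ptp _ btp nbp ytp nyp bw bpy.
rewrite seg_self nwp subnn orbF => /(_ isT isT) odd_wp.
have ev : ~~ odd (depth w - depth x).
  by move: odd_wp ltw; rewrite dd dp; clear; lia.
(* The end [b] is at most as deep as [x]. If it were as deep, [back_depth] would put [w] at distance
   3 modulo 4 from [x], which is odd. *)
have ltbx : depth b < depth x.
  have := back_depth N cyc4 wW bw.
  by move: ev ltb ltw; rewrite dd dp; clear; lia.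
exists w, b; split=> //; last by apply: contraTneq ltbx => ->; rewrite ltnn.
by rewrite (tp_le_depth N pW) // ltnW.
Qed.

(** The back edge of [x] starts at distance 0 from [x], and the one given by [subtree_escape] at
    even distance, against the parity rule at [x]. *)
Lemma child_back_parent x p y a : x \in D -> p \in D -> p \in P -> child x p ->
  back p y -> back x a -> False.
Proof.
move=> xD pD pP xp bpy bxa; have xW := subtreeW xD.
have [w [b [[wW pw] bwb btp nbx ev]]] := subtree_escape xD pD pP xp bpy.
have /andP[xtp /eqP dp] := xp; have xw := tp_trans N wW pw xtp.
have xtx := tp_self N xW; have ltw := tp_depth N wW pw.
have /and3P[_ atx ltax] := bxa.
have nax : a != x by apply: contraTneq ltax => ->; clear; lia.
have nwx : w != x by apply: contraTneq ltw => ->; rewrite dp ltnn.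
have := back_odd_or h_sym N cyc4 wW xW xw xtx _ btp nbx atx nax bwb bxa.
by rewrite seg_self nwx subnn orbF (negbTE ev) => /(_ isT isT).
Qed.

(** Each child yields a back edge starting at even distance below [x]; different children give
    separate branches, against the parity rule at [x]. *)
Lemma two_children_back x p p' y y' : x \in D -> p \in D -> p' \in D ->
  p \in P -> p' \in P -> child x p -> child x p' -> back p y -> back p' y' ->
  p = p'.
Proof.
move=> xD pD pD' pP pP' xp xp' bpy bpy'; have xW := subtreeW xD.
have [w [b [[wW pw] bwb btp nbx ev]]] := subtree_escape xD pD pP xp bpy.
have [w' [b' [[wW' pw'] bwb' btp' nbx' ev']]] := subtree_escape xD pD' pP' xp' bpy'.
have /andP[xtp /eqP dp] := xp; have /andP[xtp' /eqP dp'] := xp'.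
have xw := tp_trans N wW pw xtp; have xw' := tp_trans N wW' pw' xtp'.
apply/eqP; apply: contraT => npp'.
have disj : ~~ has [in seg x w] (seg x w').
  apply/hasPn => t; rewrite !(mem_seg N) // => /andP[tw' lt].
  apply/negP => /andP[tw _].
  have tW := tp_sub N wW tw.
  have pt : p \in tp t by rewrite (tp_le_depth N wW) // dp.
  have pt' : p' \in tp t by rewrite (tp_le_depth N wW') // dp'.
  case/negP: npp'; apply/eqP; apply: (tp_depth_inj N tW) => //.
  by rewrite dp dp'.
have nww' : w != w'.
  apply: contraNneq npp' => E; apply/eqP; apply: (tp_depth_inj N wW) => //.
    by rewrite E.
  by rewrite dp dp'.
have := back_odd_or h_sym N cyc4 wW wW' xw xw' disj btp nbx btp' nbx' bwb bwb'.
by rewrite nww' (negbTE ev) (negbTE ev') => /(_ isT).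
Qed.

(* Let x be a deepest vertex of B outside P.  Since depths in B :&: P agree
   modulo 4, x has in B two children, or a child and the end of a back edge from
   x; each such child has a back edge, which subtree_escape excludes. *)
Lemma end_block_core (B : {set X}) : B \subset z |: D ->
  {in B :&: D, forall x, 1 < #|nbrs h B x|} ->
  {in B :&: P &, forall p p', odd (depth p)./2 = odd (depth p')./2} ->
  B :&: D = set0.
Proof.
move=> sB degB mono; apply/eqP; apply: contraT => /set0Pn[x0 x0BD].
have other x y : x \in B :&: D -> exists2 y', y' \in nbrs h B x & y' != y.
  move=> xBD; have /card_gt1P[a [b [aN bN nab]]] := degB x xBD.
  have [E | ?] := eqVneq a y; last by exists a.
  by exists b => //; rewrite -E eq_sym.
have BW x : x \in B -> x \in W.
  by move/(subsetP sB)/setU1P => [-> | /subtreeW //]; apply: block_zW.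
have [x1 /andP[x1BD x1P]] : exists x, (x \in B :&: D) && (x \notin P).
  have [x0P | ?] := boolP (x0 \in P); last by exists x0; rewrite x0BD.
  have [y yN yz] := other x0 z x0BD.
  have /andP[yB hxy] : (y \in B) && h x0 y by rewrite inE in yN.
  exists y; rewrite inE yB /=; have := h_bip hxy; rewrite x0P => /= ->.
  by have /setU1P[E|->] := subsetP sB y yB; first by rewrite E eqxx in yz.
have [x /andP[xBD xP] max] :=
  @arg_maxnP _ x1 (fun x => (x \in B :&: D) && (x \notin P)) depth
    (introT andP (conj x1BD x1P)).
have /setIP[xB xD] := xBD; have xW := subtreeW xD.
have nbrP y : h x y -> y \in P.
  by move/h_bip; rewrite (negbTE xP); case: (y \in P).
have nbrNP p y : p \in P -> h p y -> y \notin P.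
  by move=> pP /h_bip; rewrite pP; case: (y \in P).
(* By the choice of [x] no vertex of [B] outside [P] is deeper than [x], so a neighbour of [p] in
   [B] cannot be a descendant of [p]; by comparability it is an ancestor. *)
have shallow p y : x \in tp p -> p \in B -> p \in P -> y \in B -> h p y ->
    y \in tp p /\ depth y <= depth x.
  move=> xp pB pP yB hpy.
  have lt_y : depth y <= depth x.
    have [yD | yD] := boolP (y \in D).
      by apply: max; rewrite inE yB yD (nbrNP p).
    have := subsetP sB y yB; rewrite in_setU1 (negbTE yD) orbF => /eqP ->.
    by rewrite ltnW // subtree_depth.
  split=> //; have [yW pW] := (BW y yB, BW p pB).
  case/orP: (nt_comparable N pW yW hpy) => // py.
  have npy : p != y by apply: contraTneq hpy => ->; rewrite (bip_irr h_bip).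
  have := tp_lt_depth N yW py npy; have := tp_depth N pW xp.
  by move: lt_y; clear; lia.
have kind p : p \in B -> h x p ->
    [\/ p \in tp x /\ depth x = (depth p).+1, back x p |
        [/\ p \in D, child x p & exists y, back p y]].
  move=> pB hxp; have pW := BW p pB; have pP := nbrP p hxp.
  have hpx : h p x by rewrite h_sym.
  case/orP: (nt_comparable N xW pW hxp) => [xp | px]; last first.
    by case/orP: (neighbour_below N h_bip xW px hxp) => [/eqP|]; [constructor 1 | constructor 2].
  have pD := subtree_up xD pW xp; constructor 3.
  have pBD : p \in B :&: D by rewrite inE pB.
  have [y yN yx] := other p x pBD.
  have /andP[yB hpy] : (y \in B) && h p y by rewrite inE in yN.
  have [yp le_y] := shallow p y xp pB pP yB hpy.
  have nxp : x != p by apply: contraTneq hxp => ->; rewrite (bip_irr h_bip).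
  have ltxp := tp_lt_depth N pW xp nxp.
  have bpy : back p y.
    case/orP: (neighbour_below N h_bip pW yp hpy) => // /eqP E.
    case/negP: yx; apply/eqP; apply: (tp_depth_inj N pW) => //.
    by move: E ltxp le_y; clear; lia.
  split=> //; last by exists y.
  case/orP: (neighbour_below N h_bip pW xp hpx) => [E | bpx].
    by rewrite /child xp.
  by case/negP: yx; rewrite (back_uniq h_sym N cyc4 pW bpy bpx).
have /card_gt1P[a [b [aN bN nab]]] := degB x xBD.
have /andP[aB hxa] : (a \in B) && h x a by rewrite inE in aN.
have /andP[bB hxb] : (b \in B) && h x b by rewrite inE in bN.
have [aP bP] := (nbrP a hxa, nbrP b hxb).
have E4 : depth a = depth b %[mod 4].
  apply: (depth_half_mod4 N h_bip); rewrite ?BW ?aP ?bP //.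
  by apply: mono; rewrite inE ?aB ?bB.
have dback p : back x p -> depth x = depth p + 3 %[mod 4] := back_depth N cyc4 xW.
case/negP: nab; apply/eqP.
(* Modulo 4 the parent of [x] is at [depth x - 1], a child or the end of a back edge at
   [depth x + 1]. As [a] and [b] agree modulo 4, the parent cannot be paired with one of the
   others. *)
case: (kind a aB hxa) => [[ax da] | bxa | [aD xa [ya baya]]];
case: (kind b bB hxb) => [[bx db] | bxb | [bD xb [yb bbyb]]].
- by apply: (tp_depth_inj N xW) => //; move: da db; clear; lia.
- by have := dback b bxb; move: E4 da; clear; lia.
- by case/andP: xb => _ /eqP; move: E4 da; clear; lia.
- by have := dback a bxa; move: E4 db; clear; lia.
- exact: (back_uniq h_sym N cyc4 xW bxa bxb).
- by case: (child_back_parent xD bD bP xb bbyb bxa).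
- by case/andP: xa => _ /eqP; move: E4 db; clear; lia.
- by case: (child_back_parent xD aD aP xa baya bxb).
- exact: (two_children_back xD aD bD aP bP xa xb baya bbyb).
Qed.

(* Otherwise one of y, y' would have a back edge to r and q as a child with a
   back edge, against child_back_parent. *)
Lemma end_block_root q y y' : z = r -> r \in P -> q \in D -> q \in P ->
  y \in U -> y' \in U -> y != y' -> h r y -> h r y' -> h q y -> h q y' ->
  odd (depth q)./2 != odd (depth r)./2.
Proof.
move=> zr rP qD qP yU yU' nyy' hry hry' hqy hqy'.
have qW := subtreeW qD; have rW := nt_root N.
apply: contraNneq nyy' => E.
have {E} E4 : depth q = depth r %[mod 4].
  by apply: (depth_half_mod4 N h_bip); rewrite ?qP.
have inD t : t \in U -> h q t -> h r t -> t \in D.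
  move=> tU hqt hrt; have := subtree_nbr qD tU hqt; rewrite zr => /setU1P[E | //].
  by move: hrt; rewrite E (bip_irr h_bip).
have rD t : t \in D -> depth r < depth t by rewrite -zr; apply: subtree_depth.
have below_c t : t \in D -> h r t -> t = c \/ back t r.
  move=> tD hrt; have tW := subtreeW tD; have htr : h t r by rewrite h_sym.
  have /orP[/eqP E | ] := neighbour_below N h_bip tW (tp_root N tW) htr; last by right.
  left; apply: (tp_depth_inj N tW).
  - exact: (tp_self N tW).
  - by move: tD; rewrite inE => /andP[].
  - by rewrite E block_depth zr.
(* Modulo 4, [t] is at [depth r + 3] and [q] at [depth r]. Together with the uniqueness of back
   edges this leaves [q] only the place of a child of [t]. *)
have q_child t : t \in D -> h q t -> back t r -> child t q.
  move=> tD hqt btr; have tW := subtreeW tD; have htq : h t q by rewrite h_sym.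
  have dt := back_depth N cyc4 tW btr.
  have /and3P[_ _ ltr] := btr.
  case/orP: (nt_comparable N qW tW hqt) => [qt | tq].
    case/orP: (neighbour_below N h_bip tW qt htq) => [/eqP E | btq].
      by move: dt E4; rewrite E; clear; lia.
    have Eq := back_uniq h_sym N cyc4 tW btq btr.
    by have := rD q qD; rewrite Eq ltnn.
  case/orP: (neighbour_below N h_bip qW tq hqt) => [E | bqt].
    by rewrite /child tq.
  by have := back_depth N cyc4 qW bqt; move: dt E4; clear; lia.
have one t t' : t \in D -> t' \in D -> h q t -> h q t' -> back t r ->
    t' = c -> False.
  move=> tD tD' hqt hqt' btr Et'; have /andP[tq /eqP dq] := q_child t tD hqt btr.
  have tq' : t' \in tp q by rewrite Et'; move: qD; rewrite inE => /andP[].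
  case/orP: (neighbour_below N h_bip qW tq' hqt') => [/eqP E | bqt'].
    have Ett' : t = t'.
      by apply: (tp_depth_inj N qW) => //; move: E; rewrite dq => -[].
    have /and3P[_ _] := btr; rewrite Ett' Et' block_depth zr.
    by rewrite ltnn.
  apply: (child_back_parent tD qD qP (q_child t tD hqt btr) bqt' btr).
have [yD yD'] := (inD y yU hqy hry, inD y' yU' hqy' hry').
apply/eqP; case: (below_c y yD hry) (below_c y' yD' hry') => [yc | by1] [yc' | by2].
- by rewrite yc yc'.
- by case: (one y' y yD' yD hqy' hqy by2).
- by case: (one y y' yD yD' hqy hqy' by1).
have /andP[yq /eqP dq] := q_child y yD hqy by1.
have /andP[yq' /eqP dq'] := q_child y' yD' hqy' by2.
by apply: (tp_depth_inj N qW) => //; move: dq; rewrite dq' => -[].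
Qed.

End EndBlock.

(** * Colouring the big vertices of V3 *)

(* K is empty or the singleton of a vertex of degree 4 that is counted in Q1;
   only the cycles avoiding K are known to have length 0 modulo 4. *)
Section Colouring.
Variables (X : finType) (h : rel X) (P Q1 Q2 K : {set X}) (v q : X).
Hypotheses (h_sym : symmetric h).
Hypothesis h_bip : forall x y, h x y -> (x \in P) != (y \in P).
Hypotheses (PQ1 : [disjoint P & Q1]) (PQ2 : [disjoint P & Q2]).
Hypotheses (Q12 : [disjoint Q1 & Q2]).
Hypotheses (K1 : #|K| <= 1) (KQ1 : K \subset Q1).
Hypothesis nbrK : forall k p, k \in K -> h k p -> p = v \/ p = q.
Hypotheses (vP : v \in P) (nqv : q != v).
Implicit Types (U C D B : {set X}) (p x y : X).

Definition good_colouring U C := [/\ C \subset P :&: U, v \in C,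
  acyclic_on h (Q1 :&: U :|: C) & acyclic_on h (Q2 :&: U :|: (P :&: U :\: C))].

Lemma nbrs_side U Q C p : p \in P -> C \subset P ->
  nbrs h (Q :&: U :|: C) p \subset nbrs h (Q :&: U) p.
Proof.
move=> pP /subsetP sCP; apply/subsetP => x; rewrite !inE => /andP[xA hpx].
have := h_bip hpx; rewrite pP; case/orP: xA => [-> // | /sCP ->].
by rewrite eqxx.
Qed.

Lemma acyclic_on_leaf_add A p :
  acyclic_on h (A :\ p) -> #|nbrs h A p| <= 1 -> acyclic_on h A.
Proof.
move=> acA leaf B sBA degB; apply: (acA B _ degB); rewrite subsetD1 sBA /=.
apply: contraL leaf => pB; rewrite -ltnNge; apply: leq_trans (degB p pB) _.
exact: subset_leq_card (nbrsS _ _ sBA).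
Qed.

Lemma PNQ p : p \in P -> (p \in Q1 = false) * (p \in Q2 = false).
Proof.
by move=> pP; rewrite (disjointFr PQ1 pP) (disjointFr PQ2 pP).
Qed.

Lemma good_colouring_add1 U C p : p \in P -> p \in U -> p != v ->
  #|nbrs h (Q1 :&: U) p| <= 1 -> good_colouring (U :\ p) C ->
  good_colouring U (p |: C).
Proof.
move=> pP pU pv leaf [sC vC ac1 ac2]; have [pQ1 pQ2] := PNQ pP.
have sC' : p |: C \subset P :&: U.
  rewrite subUset sub1set inE pP pU /=; apply: subset_trans sC _.
  by rewrite setIS // subsetDl.
split=> //; first by rewrite inE vC orbT.
- apply: (@acyclic_on_leaf_add _ p).
    apply: acyclic_onS ac1; apply/subsetP => x; rewrite !inE.
    by case: (x == p) => //=.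
  apply: leq_trans leaf; apply/subset_leq_card/nbrs_side => //.
  exact: subset_trans sC' (subsetIl _ _).
apply: acyclic_onS ac2; apply/subsetP => x; rewrite !inE.
by have [-> | _] := eqVneq x p; rewrite ?pQ2.
Qed.

Lemma good_colouring_add2 U C p : p \in P -> p \in U -> p != v ->
  #|nbrs h (Q2 :&: U) p| <= 1 -> good_colouring (U :\ p) C ->
  good_colouring U C.
Proof.
move=> pP pU pv leaf [sC vC ac1 ac2]; have [pQ1 pQ2] := PNQ pP.
have sC' : C \subset P :&: U.
  by apply: subset_trans sC _; rewrite setIS // subsetDl.
split=> //.
- apply: acyclic_onS ac1; apply/subsetP => x; rewrite !inE.
  by have [-> | _] := eqVneq x p; rewrite ?pQ1.
apply: (@acyclic_on_leaf_add _ p).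
  apply: acyclic_onS ac2; apply/subsetP => x; rewrite !inE.
  by case: (x == p) => //=.
apply: leq_trans leaf; apply/subset_leq_card/nbrs_side => //.
by rewrite -setIDA subsetIl.
Qed.

(** An invariant of the induction on [U]: it becomes vacuous once [q] is removed or [v] has no edge
    outside [K]. As long as it is not, two common neighbours force an end block that contains [q]
    below its cut vertex to hang at [v]. *)
Definition common_nbrs U := (exists2 x, x \in U :\: K & h v x) -> q \in U ->
  q \in P -> exists y y', [/\ y \in U :\: K, y' \in U :\: K, y != y',
    h v y && h v y' & h q y && h q y'].

Definition cycles4 U := forall s, {subset s <= U} -> uniq s ->
  path.cycle h s -> 2 < size s -> 4 %| size s.

(** * Colouring one end block *)

Section EndBlockStep.
Variables (U W : {set X}) (r z c : X) (tp : X -> seq X).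
Hypotheses (vU : v \in U) (cyc4 : cycles4 (U :\: K)) (comm : common_nbrs U).
Hypothesis N : normal_tree h (U :\: K) r W tp.
Hypothesis block : end_block h W tp z c.
Hypothesis deg3 : forall p, p \in P -> p \in U -> p != v ->
  2 < #|nbrs h (U :\: K) p|.
Hypothesis rv : r = v \/ {in U :\: K, forall x, ~~ h v x}.

Local Notation D := (subtree W tp c).
Local Notation half x := (odd (depth tp x)./2).

Lemma subtreeU x : x \in D -> x \in U :\: K.
Proof. by move/subtreeW; apply: (subsetP (nt_sub N)). Qed.

(** Nothing is known about the degree of [v], so the block argument must not meet it. Either [v] is
    the root, or it has no edge outside [K] and no nontrivial tree path ends there. *)
Lemma v_notin_subtree : v \notin D.
Proof.
case: rv => [<- | iso]; first exact: (root_notin_subtree N block).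
apply/negP => vD; have vW := subtreeW vD.
have [p [tpv ph lp _]] := nt_path N vW.
case/lastP: p tpv ph lp => [|p t] tpv.
  move=> _ /= rv'; have := root_notin_subtree N block.
  by rewrite rv' vD.
rewrite rcons_path last_rcons => /andP[_ hlt] Et; move: hlt; rewrite Et h_sym.
apply/negP/iso/(subsetP (nt_sub N))/(tp_sub N vW).
by rewrite tpv -rcons_cons mem_rcons inE mem_last orbT.
Qed.

(** The colouring by depth, flipped if necessary so as to agree at [z] with the colour that [z]
    already has; for [z] outside [P] there is nothing to match. *)
Definition block_colour (C : {set X}) p :=
  half p (+) ((z \in P) && (half z (+) (z \in C))).

Definition extend C := C :|: [set p in P :&: D | block_colour C p].

Lemma block_deg3 : {in D, forall p, p \in P -> 2 < #|nbrs h (U :\: K) p|}.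
Proof.
move=> p pD pP; apply: deg3 => //; first by have /setDP[] := subtreeU pD.
by apply: contraNneq v_notin_subtree => <-.
Qed.

Lemma extend_colour C p : C \subset P :&: (U :\: D) -> p \in P ->
  p \in z |: D -> (p \in extend C) = block_colour C p.
Proof.
move=> sC pP pD; rewrite !inE pP /=.
have CD x : x \in D -> x \in C = false.
  move=> xD; apply: contraTF xD => /(subsetP sC).
  by rewrite in_setI in_setD => /and3P[].
have [pD' | npD] := boolP (p \in D).
  rewrite (CD p pD'); have : p \in W /\ c \in tp p.
    by move: pD'; rewrite inE => /andP[].
  by case=> -> ->.
have Ep : p = z by move: pD; rewrite in_setU1 (negbTE npD) orbF => /eqP.
have /negbTE : ~~ ((p \in W) && (c \in tp p)) by move: npD; rewrite inE.
rewrite /block_colour -Ep pP => -> /=.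
by rewrite orbF; case: (half p); case: (p \in C).
Qed.

(** A set of minimum degree 2 on one side has one colour in the block, so [end_block_core] clears it
    from [D] and it lies in the part coloured before. Only edges to [K], unseen by the search, could
    interfere, and they concern [Q1] and [q] alone. *)
Lemma good_colouring_extend C : good_colouring (U :\: D) C ->
  good_colouring U (extend C).
Proof.
move=> [sC vC ac1 ac2].
have sE : extend C \subset P :&: U.
  rewrite subUset (subset_trans sC) ?setIS ?subsetDl //=.
  apply/subsetP => p; rewrite inE => /andP[/setIP[pP pD] _].
  by rewrite inE pP; have /setDP[] := subtreeU pD.
have vE : v \in extend C by rewrite inE vC.
have blockB (B : {set X}) (col : bool) : B \subset U ->
    (forall p, p \in B -> p \in P -> (p \in extend C) = col) ->
    {in B, forall x, 1 < #|nbrs h B x|} ->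
    (forall x k, x \in B :&: D -> k \in B -> k \in K -> ~~ h x k) ->
    B :&: D = set0.
  move=> sBU colB degB noK.
  suff : (B :&: (z |: D)) :&: D = set0.
    by rewrite -setIA (setIidPr (subsetUr _ _)).
  apply: (end_block_core h_sym N h_bip cyc4 block block_deg3).
  - exact: subsetIr.
  - move=> x /setIP[/setIP[xB _] xD]; apply: leq_trans (degB x xB) _.
    apply/subset_leq_card/subsetP => y; rewrite inE => /andP[yB hxy].
    rewrite inE hxy andbT in_setI yB /=.
    apply: (subtree_nbr N block xD _ hxy).
    rewrite in_setD (subsetP sBU) // andbT; apply: contraL hxy => yK.
    by apply: noK; rewrite // inE xB.
  - move=> p p' /setIP[/setIP[pB pD] pP] /setIP[/setIP[pB' pD'] pP'].
    have := colB p pB pP; have := colB p' pB' pP'.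
    rewrite !(extend_colour sC) // => <-.
    by rewrite /block_colour; move=> /addIb.
have restrict (B Q A A' : {set X}) : B \subset Q :&: U :|: A ->
    A \subset U -> A :\: D \subset A' ->
    B :&: D = set0 -> B \subset Q :&: (U :\: D) :|: A'.
  move=> sB sA sA' BD; apply/subsetP => x xB.
  have xD : x \notin D.
    by apply: contraT => /negbNE xD; rewrite -(in_set0 x) -BD inE xB.
  have := subsetP sB x xB; rewrite !in_setU !in_setI in_setD xD.
  case/orP => [-> // | xA]; apply/orP; right; apply: (subsetP sA').
  by rewrite in_setD xD.
split=> //.
- move=> B sB degB; apply: (ac1) => //.
  apply: (restrict _ _ _ _ sB); first exact: subset_trans sE (subsetIr _ _).
    apply/subsetP => p; rewrite in_setD in_setU inE in_setI.
    by case/andP => /negbTE ->; rewrite andbF /= orbF.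
  have sBU : B \subset U.
    apply: subset_trans sB _; rewrite subUset subsetIr.
    exact: subset_trans sE (subsetIr _ _).
  have colB p : p \in B -> p \in P -> (p \in extend C) = true.
    move=> pB pP; have := subsetP sB p pB; rewrite in_setU in_setI.
    by rewrite (PNQ pP).
  apply: (blockB B true) => // x k /setIP[xB xD] kB kK; apply/negP => hxk.
  have hkx : h k x by rewrite h_sym.
  have xq : x = q.
    by case: (nbrK kK hkx) => // Ex; have := v_notin_subtree; rewrite -Ex xD.
  rewrite {x}xq in xB xD hxk hkx.
  have KE k' : k' \in K -> k' = k.
    by move=> kK'; apply: (card_le1_eqP K1).
  have kQ1 : k \in Q1 := subsetP KQ1 k kK.
  have kP : k \notin P by rewrite (disjointFl PQ1).
  have qP : q \in P by have := h_bip hxk; rewrite (negbTE kP); case: (q \in P).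
  have [ /exists_inP[x1 x1U hvx1] | iso] := boolP [exists x in U :\: K, h v x].
    have Er : r = v by case: rv => // /(_ x1 x1U); rewrite hvx1.
    have qU := subsetP sBU q xB.
    have [|y [y' [yU yU' nyy' /andP[hvy hvy'] /andP[hqy hqy']]]] := comm _ qU qP.
      by exists x1.
    (* One of the two common neighbours lies in [D] and is adjacent to [v] outside [D], so [v] is
       the cut vertex. Then [end_block_root] gives [q] a depth colour different from that of [v],
       whereas [v] and [q] both have to be in the extension of [C]. *)
    have Ez : z = v.
      have yD : y \in z |: D := subtree_nbr N block xD yU hqy.
      have yD' : y' \in z |: D := subtree_nbr N block xD yU' hqy'.
      have hyv : h y v by rewrite h_sym.
      have hyv' : h y' v by rewrite h_sym.
      have vUK : v \in U :\: K.
        by rewrite inE vU andbT; apply: contraTN vP => /(subsetP KQ1) ?; rewrite (disjointFl PQ1).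
      have zv t : t \in D -> h t v -> z = v.
        move=> tD htv; have := subtree_nbr N block tD vUK htv.
        by rewrite in_setU1 (negbTE v_notin_subtree) orbF => /eqP.
      case/setU1P: yD => [Ey | yD]; last exact: zv yD hyv.
      case/setU1P: yD' => [Ey' | yD']; last exact: zv yD' hyv'.
      by rewrite Ey Ey' eqxx in nyy'.
    have zr : z = r by rewrite Er.
    have rP : r \in P by rewrite Er.
    rewrite -Er in hvy hvy'.
    have := end_block_root h_sym N h_bip cyc4 block block_deg3 zr rP xD qP
              yU yU' nyy' hvy hvy' hqy hqy'.
    have := colB q xB qP; rewrite (extend_colour sC) //; last by rewrite inE xD orbT.
    rewrite /block_colour zr rP /= Er vC.
    by case: (half q); case: (half v).
  (* Now all neighbours of [v] in [U] lie in [K]. The vertex [k] needs both [v] and [q] in [B], and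
     then [k] is the only neighbour of [v] in [B]. *)
  have /card_gt1P[a [b [aN bN nab]]] := degB k kB.
  have vB : v \in B.
    move: aN bN nab; rewrite !inE => /andP[aB hka] /andP[bB hkb].
    by case: (nbrK kK hka) => Ea; case: (nbrK kK hkb) => Eb; subst => //; rewrite eqxx.
  have := degB v vB; rewrite ltnNge => /negP[]; rewrite -(cards1 k).
  apply: subset_leq_card; apply/subsetP => y; rewrite !inE => /andP[yB hvy].
  apply/eqP/KE; apply: contraNT iso => yK; apply/exists_inP; exists y => //.
  by rewrite inE yK (subsetP sBU).
- move=> B sB degB; apply: (ac2) => //.
  apply: (restrict _ _ _ _ sB); first by rewrite -setIDA (subset_trans (subsetIr _ _)) // subsetDl.
    apply/subsetP => p; rewrite in_setD in_setD in_setI in_setU negb_or.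
    case/and3P => pD /andP[pC _] /andP[pP pU].
    by rewrite in_setD pC in_setI pP in_setD pD.
  have sBU : B \subset U.
    apply: subset_trans sB _; rewrite subUset subsetIr -setIDA.
    by rewrite (subset_trans (subsetIr _ _)) // subsetDl.
  apply: (blockB B false) => //.
    move=> p pB pP; have := subsetP sB p pB.
    by rewrite in_setU !in_setI in_setD (PNQ pP) => /andP[/negbTE].
  move=> x k _ kB kK; have := subsetP sB k kB.
  have kQ1 := subsetP KQ1 k kK.
  by rewrite in_setU !in_setI in_setD in_setI (disjointFr Q12) // (disjointFl PQ1) // andbF.
Qed.

End EndBlockStep.

Lemma good_colouring_isolated U C x : x \notin P -> x \in U ->
  {in U, forall y, ~~ h x y} -> good_colouring (U :\ x) C -> good_colouring U C.
Proof.
move=> xP xU iso [sC vC ac1 ac2].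
have iso_ac (A : {set X}) : A \subset U -> acyclic_on h (A :\ x) -> acyclic_on h A.
  move=> /subsetP sAU acA; apply: acyclic_on_leaf_add acA _.
  rewrite (_ : nbrs h A x = set0) ?cards0 //; apply/setP => y; rewrite !inE.
  by apply/negP => /andP[/sAU yU]; apply/negP/iso.
have sCU : C \subset P :&: U by apply: subset_trans sC _; rewrite setIS ?subsetDl.
split=> //.
- apply: iso_ac; first by rewrite subUset subsetIr (subset_trans sCU) ?subsetIr.
  apply: acyclic_onS ac1; apply/subsetP => y; rewrite !inE.
  by case: (y == x).
- apply: iso_ac; first by rewrite subUset subsetIr -setIDA
    (subset_trans (subsetIr _ _)) ?subsetDl.
  apply: acyclic_onS ac2; apply/subsetP => y; rewrite !inE.
  by case: (y == x).
Qed.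

Lemma good_colouring_exists U : U \subset P :|: Q1 :|: Q2 -> v \in U ->
  cycles4 (U :\: K) -> common_nbrs U -> exists C, good_colouring U C.
Proof.
have [n] := ubnP #|U|; elim: n U => // n IHn U ltUn sU vU cyc4 comm.
have IH U' : U' \proper U -> v \in U' -> common_nbrs U' ->
    exists C, good_colouring U' C.
  move=> /[dup] /proper_card ltU' /proper_sub sU' vU' comm'.
  apply: IHn => //; first by rewrite -ltnS (leq_trans _ ltUn).
    exact: subset_trans sU' sU.
  move=> s ss; apply: cyc4 => x /ss; rewrite !inE => /andP[-> /=].
  exact: (subsetP sU').
have comm_sub U' : U' \subset U ->
    (q \in U' -> q \in P -> {in U :\: U', forall y, h q y -> ~~ h v y}) ->
    common_nbrs U'.
  move=> sU' keep [x xU' hvx] qU' qP.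
  have sUK : U' :\: K \subset U :\: K by apply: setSD.
  have [||y [y' [/setDP[yU yK] /setDP[yU' yK'] nyy' /andP[hvy hvy'] /andP[hqy hqy']]]] := comm _ _ qP.
  - by exists x; rewrite ?(subsetP sUK).
  - exact: (subsetP sU').
  have inU' t : t \in U -> h v t -> h q t -> t \in U'.
    move=> tU hvt hqt; apply: contraTT hvt => tU'.
    by apply: keep => //; rewrite inE tU'.
  exists y, y'; rewrite hvy hvy' hqy hqy'; split=> //.
  - by rewrite inE yK inU'.
  - by rewrite inE yK' inU'.
have comm_D1 x : x \in U -> x \in P -> common_nbrs (U :\ x).
  move=> xU xP; apply: comm_sub; first exact: subsetDl.
  move=> _ _ y; rewrite !inE negb_and negbK.
  case/andP=> /orP[/eqP-> | /negbTE-> //] _ /h_bip; rewrite xP.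
  by move=> qx; apply/negP => /h_bip; rewrite vP xP.
have [p /and4P[pP pU pv leaf] | full1] :=
  pickP [pred p | [&& p \in P, p \in U, p != v & #|nbrs h (Q1 :&: U) p| <= 1]].
  have vU' : v \in U :\ p by rewrite !inE eq_sym pv.
  have [C good] := IH _ (properD1 pU) vU' (comm_D1 p pU pP).
  by exists (p |: C); apply: good_colouring_add1.
have [p /and4P[pP pU pv leaf] | full2] :=
  pickP [pred p | [&& p \in P, p \in U, p != v & #|nbrs h (Q2 :&: U) p| <= 1]].
  have vU' : v \in U :\ p by rewrite !inE eq_sym pv.
  have [C good] := IH _ (properD1 pU) vU' (comm_D1 p pU pP).
  by exists C; apply: good_colouring_add2 good.
(* Two neighbours in [Q1], at most one of them in [K], and two in [Q2]. *)
have deg3 p : p \in P -> p \in U -> p != v -> 2 < #|nbrs h (U :\: K) p|.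
  move=> pP pU pv.
  have := full1 p; rewrite /= pP pU pv /= => /negbT; rewrite -ltnNge => two1.
  have := full2 p; rewrite /= pP pU pv /= => /negbT; rewrite -ltnNge => two2.
  have one1 : 0 < #|nbrs h (Q1 :&: U) p :\: K|.
    have := cardsID K (nbrs h (Q1 :&: U) p).
    have := subset_leq_card (subsetIr (nbrs h (Q1 :&: U) p) K).
    by move: two1 K1; clear; lia.
  have disj : [disjoint nbrs h (Q1 :&: U) p :\: K & nbrs h (Q2 :&: U) p].
    rewrite -setI_eq0; apply/eqP/setP => x; rewrite !inE.
    by apply/negP; case: (boolP (x \in Q1)) => [/(disjointFr Q12)->|]; rewrite !(andbF, andFb).
  have : nbrs h (Q1 :&: U) p :\: K :|: nbrs h (Q2 :&: U) p \subset
         nbrs h (U :\: K) p.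
    apply/subsetP => x; rewrite !inE => /orP[/and3P[-> /andP[_ ->] ->] // |].
    case/andP=> /andP[xQ2 ->] ->; rewrite !andbT; apply: contraTN xQ2.
    by move/(subsetP KQ1) => xQ1; rewrite (disjointFr Q12).
  move/subset_leq_card; rewrite cardsU (disjoint_setI0 disj) cards0 subn0.
  by move: one1 two2; clear; lia.
have PK x : x \in P -> x \notin K.
  by move=> xP; apply: contraTN xP => /(subsetP KQ1) xQ1; rewrite (disjointFl PQ1).
have sUK : U :\: K \subset U by apply: subsetDl.
have split_block r : r \in U :\: K ->
    (exists2 x, x \in U :\: K & h r x) ->
    r = v \/ {in U :\: K, forall x, ~~ h v x} ->
    exists C, good_colouring U C.
  move=> rU [x xU hrx] rv.
  have [W [tp N]] := normal_tree_exists h_sym rU.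
  have xW := nt_closed N (nt_root N) xU hrx.
  have xr : x != r by apply: contraTneq hrx => ->; rewrite (bip_irr h_bip).
  have [z [c block]] := end_block_exists N xW xr.
  have cD := mem_c_subtree N block.
  have vD := v_notin_subtree N block rv.
  have [|||C good] := IH (U :\: subtree W tp c).
  - rewrite properE subsetDl; apply/subsetPn; exists c; last by rewrite inE cD.
    by apply: (subsetP sUK); apply: (subtreeU N cD).
  - by rewrite inE vD.
  - apply: comm_sub; first exact: subsetDl.
    (* A common neighbour of [v] and [q] in the removed subtree would make both of them equal to the
       cut vertex [z]. *)
    move=> /setDP[qU qD] qP y; rewrite !in_setD => /andP[yD yU] hqy.
    apply/negP => hvy; rewrite yU andbT negbK in yD.
    have zE t : t \in U -> t \notin subtree W tp c -> t \in P -> h t y -> t = z.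
      move=> tU tD tP hty; have tUK : t \in U :\: K by rewrite inE tU PK.
      have hyt : h y t by rewrite h_sym.
      have := subtree_nbr N block yD tUK hyt.
      by rewrite in_setU1 (negbTE tD) orbF => /eqP.
    by case/negP: nqv; rewrite (zE q) // (zE v).
  by exists (extend W z c tp C); apply: (good_colouring_extend vU cyc4 comm N block deg3 rv good).
have [x /andP[xU hvx] | iso_v] := pickP [pred x | (x \in U :\: K) && h v x].
  apply: (split_block v); [by rewrite inE vU PK | by exists x | by left].
have iso : {in U :\: K, forall x, ~~ h v x}.
  by move=> x xU; have := iso_v x; rewrite /= xU => /= ->.
have [r /andP[rv rU] | only_v] := pickP [pred r | (r != v) && (r \in U :\: K)].
  have [x /andP[xU hrx] | iso_r] := pickP [pred x | (x \in U :\: K) && h r x].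
    by apply: (split_block r) => //; [exists x | right].
  have [rU' rK] := setDP rU.
  have rP : r \notin P.
    apply/negP => rP; have := deg3 r rP rU' rv.
    rewrite (_ : nbrs _ _ _ = set0) ?cards0 //; apply/setP => x.
    by rewrite inE [RHS]inE; apply: iso_r.
  have isor : {in U, forall y, ~~ h r y}.
    move=> y yU; apply/negP => hry.
    have [yK | yK] := boolP (y \in K).
      have := h_bip hry; rewrite (negbTE rP) => /eqP.
      by rewrite (disjointFl PQ1) // (subsetP KQ1).
    by have := iso_r y; rewrite /= inE yK yU hry.
  have vU' : v \in U :\ r by rewrite !inE eq_sym rv.
  have [|C good] := IH _ (properD1 rU') vU'.
    apply: comm_sub; first exact: subsetDl.
    move=> _ _ y; rewrite !inE negb_and negbK => /andP[/orP[/eqP-> | /negbTE->] //] _.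
    by move=> _; rewrite h_sym isor.
  by exists C; apply: good_colouring_isolated good.
have UK x : x \in U -> x != v -> x \in K.
  by move=> xU xv; have := only_v x; rewrite /= xv inE xU andbT => /negbFE.
exists [set v]; split.
- by rewrite sub1set inE vP.
- by rewrite inE.
- move=> B sB degB; apply/setP => x; rewrite inE; apply/negP => xB.
  have := degB x xB; rewrite ltnNge => /negP[].
  have nbrB y : y \in nbrs h B x -> if x \in P then y \in K else y == v.
    rewrite inE => /andP[/(subsetP sB) yB hxy]; have := h_bip hxy.
    move: yB; rewrite !inE => /orP[/andP[yQ1 yU] | /eqP->]; last first.
      by rewrite vP; case: (x \in P).
    rewrite (disjointFl PQ1 yQ1); case: (x \in P) => // _; apply: UK => //.
    by apply: contraTneq yQ1 => ->; rewrite (disjointFr PQ1).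
  case: (x \in P) nbrB => nbrB; [apply: leq_trans K1 | rewrite -(cards1 v)];
    by apply/subset_leq_card/subsetP => y /nbrB; rewrite ?inE.
- move=> B sB degB; apply/setP => x; rewrite inE.
  apply/negP => /(subsetP sB); rewrite !inE => /orP[/andP[xQ2 xU] | /and3P[xv xP xU]].
    have xK : x \in K.
      by apply: UK xU _; apply: contraTneq xQ2 => ->; rewrite (disjointFr PQ2).
    by have := subsetP KQ1 x xK; rewrite (disjointFl Q12).
  by case/negP: (PK x xP); apply: UK.
Qed.

End Colouring.

(** * Even sets of edges of a plane graph are cuts of the dual *)

Import GRing.Theory.

(** The left kernel lies on the line of constant vectors. Connectedness enters the rank count in
    this form. *)
Lemma corank_le1 (F : fieldType) m n (A : 'M[F]_(m, n)) :
  (forall x : 'rV_m, x *m A = 0 -> exists a, x = const_mx a)%R ->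
  m <= \rank A + 1.
Proof.
move=> kerA; rewrite -leq_subLR -mxrank_ker.
apply: leq_trans (rank_leq_row (const_mx 1%R : 'rV[F]_m)).
apply/mxrankS/row_subP => i.
have [|a ->] := kerA (row i (kermx A)).
  by apply/sub_kermxP; apply: row_sub.
rewrite (_ : const_mx a = a *: const_mx 1)%R ?scalemx_sub //.
by apply/rowP => j; rewrite !mxE mulr1.
Qed.

Lemma addF2 (x : 'F_2) : (x + x = 0)%R.
Proof. by rewrite addrr_pchar2 // pchar_Fp. Qed.

Lemma addF2_eq0 (x y : 'F_2) : (x + y = 0)%R -> x = y.
Proof. by move=> xy0; rewrite -[x]addr0 -(addF2 y) addrA xy0 add0r. Qed.

Section Darts.
Variables (X : finType) (G : graph X).
Implicit Types (d : dart G) (x y z : X).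

Lemma adj_irr : irreflexive (adj G).
Proof.
move=> x; apply/negP => xx; have /andP[_] := forall_inP (graph_wf G) _ xx.
by rewrite setUid cards1.
Qed.

Lemma adj_verts x y : adj G x y -> x \in verts G.
Proof.
move=> xy; have /andP[/subsetP sV _] := forall_inP (graph_wf G) _ xy.
by apply: sV; rewrite !inE eqxx.
Qed.

Definition dart_edge d : {set X} := [set (val d).1; (val d).2].

Lemma dart_edgeP d : dart_edge d \in edges G.
Proof. exact: (valP d). Qed.

Lemma dart_neq d : (val d).1 != (val d).2.
Proof. by apply: contraTneq (valP d) => ->; rewrite adj_irr. Qed.

Lemma dart_revK : involutive (@dart_rev X G).
Proof. by move=> d; apply: val_inj; rewrite /= -surjective_pairing. Qed.

Lemma dart_edge_eq d d' : (dart_edge d == dart_edge d') =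
  (d == d') || (d == dart_rev d').
Proof.
apply/eqP/orP => [E | [/eqP-> // | /eqP->]]; last by rewrite /dart_edge setUC.
have n := dart_neq d.
have := set21 (val d).1 (val d).2; have := set22 (val d).1 (val d).2.
rewrite -/(dart_edge d) E => /set2P[E2|E2] /set2P[E1|E1].
- by rewrite E1 E2 eqxx in n.
- by right; apply/eqP/val_inj; rewrite [LHS]surjective_pairing E1 E2.
- by left; apply/eqP/val_inj; rewrite [LHS]surjective_pairing E1 E2 -surjective_pairing.
- by rewrite E1 E2 eqxx in n.
Qed.

Lemma edge_dart_ex (i : 'I_#|edges G|) :
  exists d, dart_edge d == enum_val i.
Proof.
have eG := enum_valP i; have /andP[_ /cards2P[x [y [xy E]]]] := forall_inP (graph_wf G) _ eG.
have xyG : adj G x y by rewrite /adj -E.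
by exists (exist _ (x, y) xyG); rewrite E.
Qed.

Definition edge_dart i := xchoose (edge_dart_ex i).

Lemma edge_dartP i : dart_edge (edge_dart i) = enum_val i.
Proof. exact: (eqP (xchooseP (edge_dart_ex i))). Qed.

Definition dart_index d := enum_rank_in (dart_edgeP d) (dart_edge d).

Lemma dart_indexP d : d = edge_dart (dart_index d) \/
  d = dart_rev (edge_dart (dart_index d)).
Proof.
have : dart_edge d == dart_edge (edge_dart (dart_index d)).
  by rewrite edge_dartP enum_rankK_in ?dart_edgeP.
by rewrite dart_edge_eq => /orP[]/eqP; [left | right].
Qed.

Lemma edge_dartK i : dart_index (edge_dart i) = i.
Proof. by apply: enum_val_inj; rewrite -!edge_dartP edge_dartP enum_rankK_in ?dart_edgeP. Qed.

Lemma rev_edge_dartK i : dart_index (dart_rev (edge_dart i)) = i.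
Proof.
apply: enum_val_inj; rewrite enum_rankK_in ?dart_edgeP // -edge_dartP.
by apply/eqP; rewrite dart_edge_eq eqxx orbT.
Qed.

Lemma big_darts (R : nmodType) (f : dart G -> R) :
  (\sum_d f d = \sum_i (f (edge_dart i) + f (dart_rev (edge_dart i))))%R.
Proof.
rewrite (partition_big dart_index predT) //=; apply: eq_bigr => i _.
rewrite (bigD1 (edge_dart i)) /=; last by rewrite edge_dartK.
congr (_ + _)%R; rewrite (bigD1 (dart_rev (edge_dart i))) /=; last first.
  rewrite rev_edge_dartK eqxx /=; apply/eqP => /(congr1 (fun d => (val d).1)) /=.
  by move/esym/eqP; rewrite (negbTE (dart_neq _)).
rewrite big1 ?addr0 // => d /andP[/andP[/eqP Ei nd] nd'].
by case: (dart_indexP d) => E; rewrite Ei in E; rewrite E eqxx in nd nd'.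
Qed.

Lemma card_darts : #|{: dart G}| = 2 * #|edges G|.
Proof.
have E : (\sum_(d : dart G) 1)%N = \sum_(i < #|edges G|) 2.
  exact: (big_darts (fun=> 1)).
by rewrite !sum_nat_const card_ord muln1 mulnC in E.
Qed.

End Darts.

(** * Homology of the sphere modulo 2 *)

Section EvenCut.
Variables (X : finType) (G : graph X) (s : {perm dart G}).
Hypothesis emb : plane_embedding s.
Local Notation phi := (face_perm s).
Implicit Types (d : dart G) (x y z : X).

Lemma face_permE d : phi d = s (dart_rev d).
Proof. by rewrite /face_perm permM permE. Qed.

Lemma rot_fst d : (val (s d)).1 = (val d).1.
Proof. by case: emb => _ rot _; apply/eqP; rewrite -rot -{1}[s]expg1 mem_porbit. Qed.

Lemma face_fst d : (val (phi d)).1 = (val d).2.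
Proof. by rewrite face_permE rot_fst. Qed.

Lemma vertex_darts (T : Type) (f : dart G -> T) x d d' :
  (forall d, (val d).1 = x -> f (s d) = f d) ->
  (val d).1 = x -> (val d').1 = x -> f d' = f d.
Proof.
move=> fs dx dx'; case: emb => _ rot _.
have : d' \in porbit s d by rewrite rot dx dx'.
case/porbitP => i ->; elim: i => [|i IHi]; first by rewrite expg0 perm1.
rewrite expgSr permM fs // -dx; apply/eqP; rewrite -rot; exact: mem_porbit.
Qed.

Lemma face_in d : porbit phi d \in porbits phi.
Proof. exact: imset_f. Qed.

Definition face_index d := enum_rank_in (face_in d) (porbit phi d).

Lemma face_index_phi d : face_index (phi d) = face_index d.
Proof.
apply: enum_val_inj; rewrite !enum_rankK_in ?face_in //.
by apply/eqP; rewrite eq_porbit_mem -{1}[phi]expg1 mem_porbit.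
Qed.

Lemma face_index_surj j : exists d, face_index d = j.
Proof.
have /imsetP[d _ E] := enum_valP j; exists d.
by apply: enum_val_inj; rewrite enum_rankK_in ?face_in.
Qed.

(** With [edge_vertex_mx], the boundary maps of the cell complex modulo 2. An edge with the same
    face on both sides contributes 1 + 1 = 0. *)
Definition face_edge_mx : 'M['F_2]_(#|porbits phi|, #|edges G|) :=
  (\matrix_(j, i) ((face_index (edge_dart i) == j)%:R +
                   (face_index (dart_rev (edge_dart i)) == j)%:R))%R.

Definition edge_vertex_mx : 'M['F_2]_(#|edges G|, #|verts G|) :=
  (\matrix_(i, k) (((val (edge_dart i)).1 == enum_val k)%:R +
                   ((val (edge_dart i)).2 == enum_val k)%:R))%R.

Lemma sum_delta (n : nat) (f : 'I_n -> 'F_2) j :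
  (\sum_k f k * (j == k)%:R = f j)%R.
Proof.
rewrite (bigD1 j) //= eqxx mulr1 big1 ?addr0 // => k kj.
by rewrite eq_sym (negbTE kj) mulr0.
Qed.

Lemma face_edge_mulE (x : 'rV_#|porbits phi|) i :
  ((x *m face_edge_mx) 0 i = x 0 (face_index (edge_dart i)) +
                              x 0 (face_index (dart_rev (edge_dart i))))%R.
Proof.
rewrite mxE; under eq_bigr => j _ do rewrite mxE mulrDr.
by rewrite big_split /= !sum_delta.
Qed.

Lemma face_edge_vertex0 : (face_edge_mx *m edge_vertex_mx = 0)%R.
Proof.
apply/matrixP => j k; rewrite mxE [RHS]mxE.
pose f d : 'F_2 := ((face_index d == j)%:R *
  (((val d).1 == enum_val k)%:R + ((val d).2 == enum_val k)%:R))%R.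
transitivity (\sum_d f d)%R.
  rewrite big_darts; apply: eq_bigr => i _; rewrite !mxE /f /= mulrDl.
  by congr (_ + _ * _)%R; rewrite addrC.
under eq_bigr => d _ do rewrite /f mulrDr.
rewrite big_split /=; apply: etrans (addF2 _); congr (_ + _)%R.
(* Along a face the head of [d] is the tail of [phi d], so heads and tails contribute equal sums. *)
rewrite [RHS](reindex_inj (@perm_inj _ phi)) /=.
by apply: eq_bigr => d _; rewrite face_index_phi face_fst.
Qed.

Lemma vertex_rank : #|verts G| <= \rank edge_vertex_mx + 1.
Proof.
rewrite -mxrank_tr; apply: corank_le1 => x x0.
case: emb => -[V0 conn] _ _.
pose f z : 'F_2 := (\sum_k x 0%R k * (z == enum_val k)%:R)%R.
have fE k : f (enum_val k) = x 0%R k.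
  rewrite /f -[RHS]sum_delta; apply: eq_bigr => l _.
  by rewrite (inj_eq enum_val_inj).
have f_edge (i : 'I_#|edges G|) : f (val (edge_dart i)).1 = f (val (edge_dart i)).2.
  apply: addF2_eq0; have /rowP/(_ i) := x0.
  rewrite mxE [RHS]mxE => <-; rewrite /f -big_split /=.
  by apply: eq_bigr => k _; rewrite !mxE mulrDr.
have f_dart (d : dart G) : f (val d).1 = f (val d).2.
  by case: (dart_indexP d) => ->; rewrite /= f_edge.
have f_adj y z : adj G y z -> f y = f z.
  by move=> yz; apply: (f_dart (exist _ (y, z) yz)).
have [v0 v0V] := set0Pn _ V0.
exists (f v0); apply/rowP => k; rewrite [RHS]mxE -fE.
have /connectP[p pp ->] := conn v0 (enum_val k) v0V (enum_valP k).
elim: p v0 {v0V} pp => //= y p IHp v0 /andP[/f_adj -> pp].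
exact: IHp.
Qed.

(** A function on faces with equal values across every edge is constant around each vertex, where
    the rotation is transitive, and along each edge; connectedness of [G] does the rest. *)
Lemma face_rank : #|porbits phi| <= \rank face_edge_mx + 1.
Proof.
apply: corank_le1 => x x0; case: emb => -[V0 conn] rot _.
pose f d := x 0%R (face_index d).
have f_rev d : f (dart_rev d) = f d.
  have H (i : 'I_#|edges G|) : f (edge_dart i) = f (dart_rev (edge_dart i)).
    by apply: addF2_eq0; rewrite -face_edge_mulE x0 mxE.
  by case: (dart_indexP d) => ->; rewrite ?dart_revK -H.
have f_s d : f (s d) = f d.
  by rewrite -{1}(dart_revK d) -face_permE /f face_index_phi -/(f _) f_rev.
have f_const d d' : f d = f d'.
  have dV := adj_verts (valP d); have dV' := adj_verts (valP d').
  have /connectP[p pp E] := conn _ _ dV dV'.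
  elim: p d {dV} pp E => [|y p IHp] d /= => [_ E | /andP[dy pp] E].
    by apply: (vertex_darts (x := (val d').1)).
  pose d1 : dart G := exist _ ((val d).1, y) dy.
  have -> : f d = f d1 by apply: (vertex_darts (x := (val d).1)).
  by rewrite -f_rev; apply: IHp.
have [d|no_dart] := pickP (@predT (dart G)).
  move=> _; exists (f d); apply/rowP => j; rewrite mxE.
  by have [d' <-] := face_index_surj j; apply: f_const.
by exists 0%R; apply/rowP => j; have [d] := face_index_surj j; have := no_dart d.
Qed.

(* In genus 0 every cycle is the sum, modulo 2, of the faces on one of its
   sides. *)
Lemma even_cut (g : dart G -> 'F_2) :
  (forall d, g (dart_rev d) = g d) ->
  (forall x, \sum_(d | (val d).1 == x) g d = 0)%R ->
  exists2 f : dart G -> 'F_2, forall d, f (phi d) = f d &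
    forall d, (f d + f (dart_rev d) = g d)%R.
Proof.
move=> g_rev g_even.
pose gv : 'rV['F_2]_#|edges G| := (\row_i g (edge_dart i))%R.
have gv0 : (gv *m edge_vertex_mx = 0)%R.
  apply/rowP => k; rewrite mxE [RHS]mxE -[RHS](g_even (enum_val k)).
  rewrite [RHS]big_mkcond big_darts; apply: eq_bigr => i _.
  rewrite !mxE /= g_rev mulrDr.
  by do 2 case: (_ == _); rewrite ?mulr0 ?mulr1 ?addr0.
have sub_A : (face_edge_mx <= kermx edge_vertex_mx)%MS.
  by apply/sub_kermxP; apply: face_edge_vertex0.
(* The kernel has dimension at most [|E| - (|V| - 1)], which by Euler's formula is [|F| - 1], and
   [face_rank] bounds the rank of the other map below by the same number. *)
have sub_ker : (kermx edge_vertex_mx <= face_edge_mx)%MS.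
  rewrite -(geq_leqif (mxrank_leqif_sup sub_A)) mxrank_ker.
  case: emb => _ _; have := vertex_rank; have := face_rank.
  move: (\rank face_edge_mx) (\rank edge_vertex_mx) => a b.
  by move: #|porbits phi| => f; clear; lia.
have /submxP[y gvE] : (gv <= face_edge_mx)%MS.
  by apply: submx_trans sub_ker; apply/sub_kermxP.
exists (fun d => y 0%R (face_index d)) => d; first by rewrite face_index_phi.
have H (i : 'I_#|edges G|) : (y 0 (face_index (edge_dart i)) +
    y 0 (face_index (dart_rev (edge_dart i))) = g (edge_dart i))%R.
  by rewrite -face_edge_mulE -gvE mxE.
by case: (dart_indexP d) => ->; rewrite ?dart_revK ?g_rev -H // addrC.
Qed.

End EvenCut.

(** * Crossing paths *)

Section Crossing.
Variables (X : finType) (G : graph X) (s : {perm dart G}).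
Hypothesis emb : plane_embedding s.
Local Notation phi := (face_perm s).
Implicit Types (d : dart G) (x y z : X).

(* The neighbour of x that follows y in the cyclic order around x; junk value y
   if y is not a neighbour of x. *)
Definition turn x y : X :=
  if insub (x, y) is Some d then (val (s (d : dart G))).2 else y.

Lemma turnE d x y : val d = (x, y) -> val (s d) = (x, turn x y).
Proof.
move=> dxy; rewrite [LHS]surjective_pairing (rot_fst emb) dxy /=.
by rewrite /turn -dxy valK.
Qed.

Lemma adj_dart x y : adj G x y -> exists d, val d = (x, y).
Proof. by move=> xy; exists (exist _ (x, y) xy). Qed.

Lemma turn_adj x y : adj G x y -> adj G x (turn x y).
Proof.
by case/adj_dart => d dxy; have := valP (s d); rewrite (turnE dxy).
Qed.

Definition traversals x y d : 'F_2 :=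
  ((val d == (x, y))%:R + (val d == (y, x))%:R)%R.

Fixpoint walk x (p : seq X) d : 'F_2 :=
  if p is y :: p' then (traversals x y d + walk y p' d)%R else 0%R.

Lemma walk_rev x p d : walk x p (dart_rev d) = walk x p d.
Proof.
elim: p x => //= y p IHp x; rewrite {}IHp; congr (_ + _)%R.
rewrite /traversals addrC; case: d => -[a b] ab /=.
by rewrite !xpair_eqE ![(b == _) && _]andbC.
Qed.

Lemma walk_rcons x p y d :
  walk x (rcons p y) d = (walk x p d + traversals (last x p) y d)%R.
Proof.
by elim: p x => /= [|z p IHp] x; rewrite ?addr0 ?add0r // IHp addrA.
Qed.

Lemma walk_notin x p d :
  ((val d).1 \notin x :: p) || ((val d).2 \notin x :: p) -> walk x p d = 0%R.
Proof.
elim: p x => //= y p IHp x H; rewrite IHp ?addr0; last first.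
  by case/orP: H; rewrite inE negb_or => /andP[_ ->]; rewrite ?orbT.
rewrite /traversals; case: d H {IHp} => -[a b] ab /=.
rewrite !xpair_eqE !inE !negb_or.
by case/orP => /and3P[/negbTE-> /negbTE-> _]; rewrite ?andbF addr0.
Qed.

Lemma sum_traversals x y z : adj G x y ->
  (\sum_(d : dart G | (val d).1 == z) traversals x y d = (z == x)%:R + (z == y)%:R)%R.
Proof.
have one a b : adj G a b ->
    (\sum_(d : dart G | (val d).1 == z) (val d == (a, b))%:R = (z == a)%:R :> 'F_2)%R.
  move=> /adj_dart[d0 Ed0]; rewrite big_mkcond (bigD1 d0) //= big1 => [|d nd].
    by rewrite Ed0 eqxx addr0 /= eq_sym; case: (z == a).
  rewrite -Ed0 (inj_eq val_inj) (negbTE nd).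
  by case: ifP.
by move=> xy; rewrite big_split /= !one // adj_sym.
Qed.

Lemma sum_walk x p z : path (adj G) x p ->
  (\sum_(d : dart G | (val d).1 == z) walk x p d = (z == x)%:R + (z == last x p)%:R)%R.
Proof.
elim: p x => /= [|y p IHp] x => [_ | /andP[xy yp]].
  by rewrite big1 // addF2.
rewrite big_split /= sum_traversals // IHp // addrA; congr (_ + _)%R.
by rewrite -addrA addF2 addr0.
Qed.

(** Let [c] and [d] follow [b] around [u], and let [f] mark the sides of the closed walk from [u] to
    [a], through [S] to [c] and back to [u]. The walk avoids [T], so [f] is constant along the path
    in [T] and around its vertices; but turning from [ub] to [ud] around [u] passes exactly one edge
    of the walk, [uc], where [f] changes. *)
Lemma crossing (S T : {set X}) u a b :
  u \notin S -> u \notin T -> [disjoint S & T] ->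
  adj G u a -> adj G u b -> a \in S -> turn u b \in S -> a != turn u b ->
  b \in T -> turn u (turn u b) \in T ->
  connect (rel_on (adj G) S) a (turn u b) ->
  connect (rel_on (adj G) T) b (turn u (turn u b)) -> False.
Proof.
move=> uS uT ST ua ub aS cS ac bT dT conS conT.
have uc := turn_adj ub; have ud := turn_adj uc.
set c := turn u b in cS ac dT conS conT uc ud *; set d := turn u c in dT conT ud *.
have ST' x : x \in T -> x \notin S by move=> xT; rewrite (disjointFl ST).
have [p pS Ec] := connectP conS.
have pG : path (adj G) a p by apply: sub_path pS => x y /and3P[].
have subS : {subset a :: p <= S}.
  move=> x; rewrite inE => /orP[/eqP-> // | ]; elim: p a {Ec pG conS ua aS ac} pS => //= y p IHp a.
  case/andP=> /and3P[_ yS _] yp; rewrite inE => /orP[/eqP-> // |].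
  exact: IHp yp.
pose g := walk u (a :: rcons p u).
have closed : path (adj G) u (a :: rcons p u).
  by rewrite /= ua rcons_path pG -Ec adj_sym uc.
have notin x : x \notin S -> x != u -> x \notin u :: a :: rcons p u.
  move=> xS xu; rewrite inE (negbTE xu) /= -rcons_cons mem_rcons inE (negbTE xu) /=.
  exact: contra (subS x) xS.
have g_out e x : x \notin S -> x != u ->
    ((val e).1 == x) || ((val e).2 == x) -> g e = 0%R.
  move=> xS xu xe; apply: walk_notin.
  by case/orP: xe => /eqP ->; rewrite (notin x xS xu) ?orbT.
have [|f f_phi f_rev] := even_cut emb (walk_rev u (a :: rcons p u)).
  move=> x; rewrite sum_walk // -[last _ _]/(last a (rcons p u)) last_rcons.
  exact: addF2.
have f_rev0 e x : x \notin S -> x != u ->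
    ((val e).1 == x) || ((val e).2 == x) -> f (dart_rev e) = f e.
  by move=> xS xu xe; apply/esym/addF2_eq0; rewrite f_rev; apply: (g_out e x).
have f_s e : f (s e) = f (dart_rev e).
  by rewrite -[in LHS](dart_revK e) -(face_permE s) f_phi.
have T_u x : x \in T -> x != u by move=> xT; apply: contraTneq xT => ->.
have [bu ebu] : exists e : dart G, val e = (b, u) by apply: adj_dart; rewrite adj_sym.
have f_T x e : connect (rel_on (adj G) T) b x -> (val e).1 = x -> f e = f bu.
  have at_vertex y e1 e2 : y \in T -> (val e1).1 = y -> (val e2).1 = y -> f e1 = f e2.
    move=> yT e1y e2y; apply: (vertex_darts emb) e2y e1y => e' e'y.
    by rewrite f_s (@f_rev0 e' y) ?ST' ?T_u // e'y eqxx.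
  case/connectP => r rT -> {x}; have : (val bu).1 = b by rewrite ebu.
  elim: r b bT bu {ebu conT ub c uc cS ac conS Ec d ud dT closed notin g_out} rT => /= [|y r IHr] b bT bu.
    by move=> _ ebu eb; apply: at_vertex eb ebu.
  case/andP=> /and3P[_ yT] /adj_dart[e1 Ee1] yr ebu er.
  rewrite (IHr y yT (dart_rev e1)) //= ?Ee1 //.
  rewrite (@f_rev0 e1 y) ?ST' ?T_u // ?Ee1 ?eqxx ?orbT //.
  by apply: at_vertex ebu; rewrite ?Ee1.
have [ub' eub] := adj_dart ub.
have Ebu : bu = dart_rev ub' by apply: val_inj; rewrite ebu /= eub.
have esub : val (s ub') = (u, c) by rewrite (turnE eub).
have essub : val (s (s ub')) = (u, d) by rewrite (turnE esub).
have f_uc : f (s ub') = f bu by rewrite f_s Ebu.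
(* The walk uses this edge once: it leaves [u] towards [a], which differs from [c], and stays in [S]
   until the final return. *)
have g_uc : g (s ub') = 1%R.
  have au : a != u by apply: contraTneq aS => ->.
  have cu : c != u by apply: contraTneq cS => ->.
  rewrite /g /= walk_rcons walk_notin /=; last first.
    by rewrite esub (contra (subS u)).
  rewrite -Ec /traversals esub !xpair_eqE !eqxx /= [u == a]eq_sym (negbTE au).
  by rewrite [u == c]eq_sym (negbTE cu) eq_sym (negbTE ac) !add0r.
have f_ud : f (s (s ub')) = (f bu + 1)%R.
  by rewrite f_s -g_uc -f_uc -[g _]f_rev addrA addF2 add0r.
have f_du : f (dart_rev (s (s ub'))) = f bu.
  by apply: (f_T d); rewrite //= essub.
have : f (dart_rev (s (s ub'))) = f (s (s ub')).
  by apply: (@f_rev0 _ d); rewrite ?ST' ?T_u // essub eqxx orbT.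
rewrite f_du f_ud -{1}[f bu]addr0 => /addrI/eqP.
by rewrite eq_sym oner_eq0.
Qed.

End Crossing.

(** * Rotations in plane triangulations *)

Section Rotation.
Variables (X : finType) (G : graph X) (s : {perm dart G}).
Hypothesis emb : plane_embedding s.
Local Notation turn := (turn s).
Implicit Types (d : dart G) (x y z u : X).

Lemma iter_turnE d x y i : val d = (x, y) ->
  val ((s ^+ i)%g d) = (x, iter i (turn x) y).
Proof.
by move=> dxy; elim: i => [|i IHi]; rewrite ?expg0 ?perm1 // expgSr permM (turnE emb IHi).
Qed.

Lemma turn_orbit x y z : adj G x y -> adj G x z -> exists i, z = iter i (turn x) y.
Proof.
move=> /adj_dart[d dE] /adj_dart[d' dE']; case: (emb) => _ rs _.
have /porbitP[i Ei] : d' \in porbit s d by rewrite rs dE dE'.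
by exists i; have := iter_turnE i dE; rewrite -Ei dE' => -[].
Qed.

Lemma iter_turn_adj x y i : adj G x y -> adj G x (iter i (turn x) y).
Proof. by move=> xy; elim: i => //= i; apply: turn_adj. Qed.

Lemma deg_le_period x y k : adj G x y -> 0 < k -> iter k (turn x) y = y ->
  {subset [set z | adj G x z] <= traject (turn x) y k}.
Proof.
move=> xy k0 per z; rewrite inE => /(turn_orbit xy)[i ->].
have per_mul j : iter (j * k) (turn x) y = y.
  by elim: j => // j IHj; rewrite mulSn iterD IHj.
rewrite {1}(divn_eq i k) addnC iterD per_mul.
by apply/trajectP; exists (i %% k) => //; rewrite ltn_mod.
Qed.

Lemma deg_porbit d x y : val d = (x, y) -> deg G x = #|porbit s d|.
Proof.
move=> dE; rewrite -(card_in_imset (f := fun e : dart G => (val e).2)).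
  apply: eq_card => z; rewrite inE; apply/idP/imsetP => [/adj_dart[e eE]|].
    by exists e; rewrite ?eE //; case: emb => _ -> _; rewrite dE eE.
  case=> e ed ->; suff <- : (val e).1 = x by apply: (valP e).
  by move: ed; case: emb => _ -> _; rewrite dE => /eqP.
move=> e e'; case: emb => _ rs _; rewrite !rs => /eqP E1 /eqP E1' E2.
by apply: val_inj; rewrite [LHS]surjective_pairing [RHS]surjective_pairing E1 E1' E2.
Qed.

Lemma iter_turn_deg x y : adj G x y -> iter (deg G x) (turn x) y = y.
Proof.
case/adj_dart => d dE; rewrite (deg_porbit dE).
have := iter_turnE #|porbit s d| dE; rewrite permX iter_porbit dE.
by case.
Qed.

Lemma closed_verts (A : {set X}) x : x \in A -> x \in verts G ->
  (forall y z, y \in A -> adj G y z -> z \in A) -> verts G \subset A.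
Proof.
move=> xA xV clA; apply/subsetP => y yV.
case: emb => -[_ conn] _ _; have /connectP[p pp ->] := conn x y xV yV.
elim: p x xA {xV} pp => //= z p IHp x xA /andP[xz].
exact: IHp (clA _ _ xA xz).
Qed.

End Rotation.

(** * Vertices of degree 4 in an even triangulation *)

Section Triangulation.
Variables (X : finType) (G : graph X) (s : {perm dart G}).
Hypothesis tri : plane_triangulation s.
Hypothesis ge4 : 4 <= #|verts G|.
Hypothesis even_deg : {in verts G, forall x, ~~ odd (deg G x)}.
Local Notation turn := (turn s).
Implicit Types (d : dart G) (x y z u : X).

Let emb : plane_embedding s := proj1 tri.

(** The face walk from the dart [(y, x)] closes up after three steps. *)
Lemma turn_tri x y : adj G x y -> turn (turn x y) x = y.
Proof.
move=> /[dup] /(turn_adj emb) /adj_dart[e eE]; rewrite adj_sym => /adj_dart[d dE].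
have phiE (d1 : dart G) a b : val d1 = (a, b) -> val (face_perm s d1) = (b, turn b a).
  by move=> E; rewrite face_permE (turnE emb (x := b) (y := a)) //= E.
have E1 := phiE _ _ _ dE; have E2 := phiE _ _ _ E1; have E3 := phiE _ _ _ E2.
have := iter_porbit (face_perm s) d; case: tri => _ -> /= E.
by move: E3; rewrite E dE => -[].
Qed.

Lemma turn_tri2 x y : adj G x y -> turn y (turn x y) = x.
Proof.
move=> xy; have zx : adj G (turn x y) x by rewrite adj_sym turn_adj.
by have := turn_tri zx; rewrite (turn_tri xy).
Qed.

Lemma turn_tri_adj x y : adj G x y -> adj G (turn x y) y.
Proof.
move=> xy; rewrite -{2}(turn_tri xy); apply: turn_adj => //.
by rewrite adj_sym turn_adj.
Qed.

Lemma turn_inj x y z : adj G x y -> adj G x z -> turn x y = turn x z -> y = z.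
Proof. by move=> xy xz E; rewrite -(turn_tri xy) E turn_tri. Qed.

Lemma deg_gt0 x : x \in verts G -> 0 < deg G x.
Proof.
move=> xV; rewrite card_gt0; apply: contraTneq ge4 => x0; rewrite -ltnNge.
suff /subset_leq_card : verts G \subset [set x] by rewrite cards1; lia.
apply: (closed_verts emb (x := x)); rewrite ?inE // => y z /set1P ->.
by move=> xz; have := in_set0 z; rewrite -x0 inE xz.
Qed.

Lemma card_set3_le (a b c : X) : #|[set a; b; c]| <= 3.
Proof.
by rewrite setUC; apply: leq_trans (leq_card_setU _ _) _; rewrite cards1 cards2; case: eqP.
Qed.

(** The two neighbours of such an [x] would have no neighbours but [x] and each other, and
    connectedness would leave only three vertices. *)
Lemma deg_neq2 x : x \in verts G -> deg G x != 2.
Proof.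
move=> xV; have [a ax] : exists a, a \in [set a | adj G x a].
  by apply/set0Pn; rewrite -card_gt0 deg_gt0.
rewrite inE in ax; apply: contraTneq ge4 => d2; rewrite -ltnNge.
pose b := turn x a; have xb : adj G x b by apply: turn_adj.
have xba : turn x b = a by have := iter_turn_deg emb ax; rewrite d2.
have bx : turn b x = a := turn_tri ax; have ab : turn a b = x := turn_tri2 ax.
have ax' : turn a x = b by rewrite -xba turn_tri.
have ba : turn b a = x by rewrite -{1}xba turn_tri2.
have axG : adj G a x by rewrite adj_sym.
have bxG : adj G b x by rewrite adj_sym.
suff /subset_leq_card : verts G \subset [set x; a; b].
  by have := card_set3_le x a b; lia.
have nbr2 t t1 t2 : adj G t t1 -> turn t t1 = t2 -> turn t t2 = t1 ->
    forall z, adj G t z -> (z == t1) || (z == t2).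
  move=> tt1 E1 E2 z tz.
  have := deg_le_period emb tt1 (isT : 0 < 2); rewrite /= E1 E2 => /(_ erefl z).
  by rewrite !inE => /(_ tz).
apply: (closed_verts emb (x := x)); rewrite ?inE ?eqxx // => y z.
rewrite !inE => /orP[/orP[]|] /eqP->.
- by move/(nbr2 _ _ _ ax erefl xba) => /orP[]->; rewrite ?orbT.
- by move/(nbr2 _ _ _ axG ax' ab) => /orP[]->; rewrite ?orbT.
- by move/(nbr2 _ _ _ bxG bx ba) => /orP[]->; rewrite ?orbT.
Qed.

Lemma deg_small x : x \in verts G -> deg G x < 6 -> deg G x = 4.
Proof.
move=> xV; have := deg_gt0 xV; have := deg_neq2 xV; have := even_deg xV.
by case: (deg G x) => [|[|[|[|[|[|]]]]]].
Qed.

Lemma small_nbrs u a : adj G u a -> deg G u < 6 ->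
  [/\ turn u (turn u (turn u (turn u a))) = a,
      forall z, adj G u z ->
        z \in [:: a; turn u a; turn u (turn u a); turn u (turn u (turn u a))] &
      uniq [:: a; turn u a; turn u (turn u a); turn u (turn u (turn u a))]].
Proof.
move=> ua small; have d4 := deg_small (adj_verts ua) small.
have per : iter 4 (turn u) a = a by rewrite -{2}(iter_turn_deg emb ua) d4.
have sub := deg_le_period emb ua (isT : 0 < 4) per.
split=> // [z uz | ]; first by apply: (sub z); rewrite inE.
rewrite -[X in uniq X]/(traject (turn u) a 4).
have sz : size (traject (turn u) a 4) <= size (enum [set z | adj G u z]).
  by rewrite size_traject -cardE -/(deg G u) d4.
rewrite (leq_size_uniq (enum_uniq _) _ sz) // => z; rewrite mem_enum.
exact: sub.
Qed.

Section Classes.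
Variable V3 : {set X}.
Hypothesis ind3 : independent G V3.

(** Consecutive neighbours of [u] are adjacent, so two of its four neighbours in an independent set
    are opposite. *)
Lemma small_V3_nbr u p q : u \notin V3 -> deg G u < 6 -> adj G u p ->
  adj G u q -> p \in V3 -> q \in V3 -> p != q -> q = turn u (turn u p).
Proof.
move=> uV small up uq pV qV npq; have [_ nbr _] := small_nbrs up small.
have nadj z : z \in V3 -> adj G p z -> False.
  by move=> zV; apply/negP; apply: ind3.
have upp := turn_adj emb up; have upp2 := turn_adj emb upp.
have upp3 := turn_adj emb upp2.
have := nbr q uq; rewrite !inE eq_sym (negbTE npq) /=.
case/or3P => /eqP E //.
- by case: (nadj q qV); rewrite E adj_sym turn_tri_adj.
- case: (nadj q qV); rewrite E; have [per _ _] := small_nbrs up small.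
  by rewrite -{1}per turn_tri_adj.
Qed.

(** The neighbours of [p] just before and after [u] are the other two neighbours of [u], hence
    adjacent to [q] as well. So common neighbours of [p] and [q] can be followed around [p] while
    they have degree 4. *)
Lemma small_common u p q : u \notin V3 -> deg G u < 6 -> adj G u p ->
  adj G u q -> p \in V3 -> q \in V3 -> p != q ->
  [/\ turn u q = turn p u, turn u (turn p u) = p,
      turn u (turn u p) = q, adj G q (turn p u) & adj G q (turn u p)].
Proof.
move=> uV small up uq pV qV npq.
have qE := small_V3_nbr uV small up uq pV qV npq.
have [per _ _] := small_nbrs up small.
have pu : adj G p u by rewrite adj_sym.
have rupu : turn u (turn p u) = p := turn_tri2 pu.
have uz : adj G u (turn p u) by rewrite adj_sym turn_tri_adj.
have uqp : turn u q = turn p u.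
  apply: (@turn_inj u) => //; first exact: turn_adj.
  by rewrite rupu qE per.
split=> //; first by rewrite -uqp adj_sym turn_tri_adj.
by rewrite qE turn_tri_adj // turn_adj.
Qed.

(* Going around v from w in both directions, all vertices up to the first big
   one are neighbours of q; were these two big vertices equal, their degree
   would be 4. *)
Lemma big_common v q w x : v \in V3 -> q \in V3 -> v != q -> w \notin V3 ->
  deg G w < 6 -> adj G v w -> adj G q w -> adj G v x -> 6 <= deg G x ->
  exists y y', [/\ 6 <= deg G y, 6 <= deg G y', y != y',
    adj G v y && adj G v y' & adj G q y && adj G q y'].
Proof.
move=> vV qV nvq wV wsmall vw qw vx xbig.
have notV3 z : adj G v z -> z \notin V3.
  by move=> vz; apply: contraL vz => zV; apply: ind3.
have step u : adj G v u -> adj G q u -> deg G u < 6 ->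
    [/\ turn u q = turn v u, turn u (turn v u) = v,
      turn u (turn u v) = q, adj G q (turn v u) & adj G q (turn u v)].
  move=> vu qu small; apply: small_common; rewrite ?(adj_sym G u) ?notV3 //.
pose R u := adj G v u && adj G q u.
have first_big f : (forall u, R u -> deg G u < 6 -> R (f u)) ->
    (exists i, x = iter i f w) ->
    exists u, [/\ R u, deg G u < 6, R (f u) & 6 <= deg G (f u)].
  move=> Rf [i Ei].
  have ex : exists i, 6 <= deg G (iter i f w) by exists i; rewrite -Ei.
  case: (ex_minnP ex) => -[|k] big min; first by move: big; rewrite /= leqNgt wsmall.
  have small j : j <= k -> deg G (iter j f w) < 6.
    by move=> jk; rewrite ltnNge; apply/negP => /min; rewrite ltnNge jk.
  have Rj j : j <= k -> R (iter j f w).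
    elim: j => [_|j IHj jk] /=; first by rewrite /R vw qw.
    by apply: Rf; [apply: IHj | apply: small]; apply: ltnW.
  exists (iter k f w); rewrite Rj ?small //; split=> //.
  by apply: Rf; [apply: Rj | apply: small].
have [||u [/andP[vu qu] usmall /andP[vy qy] ybig]] := first_big (turn v).
- move=> u /andP[vu qu] small; have [_ _ _ qz _] := step u vu qu small.
  by rewrite /R (turn_adj emb vu).
- exact: (turn_orbit emb vw vx).
have [||u' [/andP[vu' qu'] usmall' /andP[vy' qy'] ybig']] := first_big (turn^~ v).
- move=> t /andP[vt qt] small; have [_ _ _ _ qz] := step t vt qt small.
  have tv : adj G t v by rewrite adj_sym.
  by rewrite /R qz adj_sym turn_tri_adj.
- have [i Ei] := turn_orbit emb vx vw; exists i; rewrite Ei.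
  elim: i {Ei} => // i IHi; rewrite iterSr iterS turn_tri //.
  exact: iter_turn_adj.
exists (turn v u), (turn u' v); rewrite vy vy' qy qy'; split=> //.
(* If both walks stopped at the same vertex, its neighbours in cyclic order would be [v], [u], [q],
   [u']. *)
apply: contraL ybig => /eqP E; rewrite -ltnNge.
have [Euq Eu _ _ _] := step u vu qu usmall.
have [_ _ Eu' _ _] := step u' vu' qu' usmall'.
have uq : adj G u q by rewrite adj_sym.
have uv' : adj G u' v by rewrite adj_sym.
have E1 : turn (turn v u) v = u := turn_tri vu.
have E2 : turn (turn v u) u = q by rewrite -Euq turn_tri.
have E3 : turn (turn v u) q = u'.
  by rewrite E -Eu' turn_tri2 // turn_adj.
have E4 : turn (turn v u) u' = v by rewrite E turn_tri.
have yv : adj G (turn v u) v by rewrite adj_sym.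
have per : iter 4 (turn (turn v u)) v = v by rewrite /= E1 E2 E3 E4.
have sub := deg_le_period emb yv (isT : 0 < 4) per.
apply: leq_trans (_ : 4 < 6) => //; rewrite ltnS.
rewrite -(size_traject (turn (turn v u)) v 4) /deg cardE.
apply: uniq_leq_size (enum_uniq _) _ => z; rewrite mem_enum; exact: sub.
Qed.

End Classes.

End Triangulation.

(** * Complementary forests are trees *)

Section ForestsAreTrees.
Variables (X : finType) (G : graph X) (s : {perm dart G}).
Hypothesis tri : plane_triangulation s.
Implicit Types (d : dart G) (x y z u : X) (A S T : {set X}).
Local Notation phi := (face_perm s).

Let emb : plane_embedding s := proj1 tri.

Lemma card_darts_faces : #|{: dart G}| = 3 * #|porbits phi|.
Proof.
have E : (\sum_(d : dart G) 1)%N =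
    \sum_(F in porbits phi) \sum_(d : dart G | porbit phi d == F) 1.
  by apply: partition_big => d _; apply: imset_f.
rewrite sum_nat_const muln1 in E; rewrite E mulnC -sum_nat_const.
apply: eq_bigr => F /imsetP[d0 _ ->].
rewrite sum1dep_card -[RHS](proj2 tri d0); apply: eq_card => d.
by rewrite inE eq_porbit_mem.
Qed.

Lemma adj_induced A x y :
  adj (induced G A) x y = [&& x \in A, y \in A & adj G x y].
Proof.
rewrite {1}/adj /= inE subUset !sub1set -/(adj G x y).
by rewrite andbC -andbA.
Qed.

Lemma face_triangle d : (val (phi (phi d))).2 = (val d).1 /\
  adj G (val d).1 (val (phi d)).2.
Proof.
have E3 : phi (phi (phi d)) = d.
  by have := iter_porbit phi d; case: tri => _ ->.
have E : (val (phi (phi d))).2 = (val d).1 by rewrite -{2}E3 (face_fst emb).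
split=> //; have : adj G (val (phi (phi d))).1 (val (phi (phi d))).2 := valP (phi (phi d)).
by rewrite E (face_fst emb) adj_sym.
Qed.

Lemma acyclic_triangle_free A x y z : acyclic_on (adj G) A ->
  x \in A -> y \in A -> z \in A -> adj G x y -> adj G y z -> adj G x z -> False.
Proof.
move=> acA xA yA zA xy yz xz.
have nxy : x != y by apply: contraTneq xy => ->; rewrite adj_irr.
have nyz : y != z by apply: contraTneq yz => ->; rewrite adj_irr.
have nxz : x != z by apply: contraTneq xz => ->; rewrite adj_irr.
have := acyclic_on_cycle (adj_sym G) acA (c := [:: x; y; z]).
rewrite /= !inE negb_or nxy nxz nyz xy yz adj_sym xz => H.
suff : 2 < 2 by []; apply: H => // t.
by rewrite !inE => /or3P[]/eqP->.
Qed.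

Definition inner_darts A := [set d : dart G | ((val d).1 \in A) && ((val d).2 \in A)].

Lemma card_inner_darts A : #|inner_darts A| = \sum_(x in A) #|nbrs (adj G) A x|.
Proof.
rewrite -sum1_card (partition_big (fun d : dart G => (val d).1) (fun x => x \in A)) /=; last first.
  by move=> d; rewrite inE => /andP[].
apply: eq_bigr => x xA; rewrite sum1dep_card.
rewrite -(card_in_imset (f := fun d : dart G => (val d).2)); last first.
  move=> d d'; rewrite !inE => /andP[_ /eqP E1] /andP[_ /eqP E1'] E2.
  by apply: val_inj; rewrite [LHS]surjective_pairing [RHS]surjective_pairing E1 E1' E2.
apply: eq_card => y; rewrite !inE; apply/imsetP/andP => [[d]|[yA /adj_dart[d dE]]].
  rewrite !inE => /andP[/andP[_ yA] /eqP <-] ->; split=> //; exact: (valP d).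
exists d; last by rewrite dE.
by rewrite !inE -[sval d]/(val d) dE /= xA yA eqxx.
Qed.

(* Each face has exactly one edge inside S or inside T, so that the forests
   G[S] and G[T] have #|verts G| - 2 edges altogether. *)
Lemma forests_trees S T : S :|: T = verts G -> [disjoint S & T] ->
  S != set0 -> T != set0 -> acyclic_on (adj G) S -> acyclic_on (adj G) T ->
  tree_bipartition G S T.
Proof.
move=> STE ST S0 T0 acS acT.
have inST x : x \in verts G -> (x \in T) = (x \notin S).
  rewrite -STE inE; have [xS _ | //] := boolP (x \in S).
  by rewrite (disjointFr ST).
have dartST d : ((val d).1 \in T) = ((val d).1 \notin S).
  by apply: inST; apply: adj_verts (valP d).
pose mono d : nat := ((val d).1 \in S) == ((val d).2 \in S).
have one d : mono d + mono (phi d) + mono (phi (phi d)) = 1.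
  have [E adj3] := face_triangle d.
  rewrite /mono E !(face_fst emb).
  have := dartST d; have := dartST (phi d); have := dartST (phi (phi d)).
  have adj2 := valP (phi d); have adj1 := valP d.
  rewrite !(face_fst emb) /= in adj2 *.
  move: (val d).1 (val d).2 (val (phi d)).2 adj1 adj2 adj3 => x y z xy yz xz.
  case: (boolP (x \in S)) => xS; case: (boolP (y \in S)) => yS;
    case: (boolP (z \in S)) => zS //= zT yT xT.
    by case: (acyclic_triangle_free acS xS yS zS).
  by case: (acyclic_triangle_free acT xT yT zT).
have mono_sum : \sum_d mono d = #|inner_darts S| + #|inner_darts T|.
  have disj : [disjoint inner_darts S & inner_darts T].
    rewrite -setI_eq0; apply/eqP/setP => d; rewrite !inE dartST.
    by case: ((val d).1 \in S); rewrite /= ?andbF.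
  transitivity #|inner_darts S :|: inner_darts T|; last first.
    by rewrite cardsU (disjoint_setI0 disj) cards0 subn0.
  rewrite -sum1_card [RHS]big_mkcond /=; apply: eq_bigr => d _.
  have E2 : ((val d).2 \in T) = ((val d).2 \notin S) := dartST (dart_rev d).
  rewrite /mono !inE dartST E2.
  by case: (_ \in S); case: (_ \in S).
have mono3 : 3 * \sum_d mono d = #|{: dart G}|.
  have re f : \sum_d f (phi d) = \sum_d f d :> nat.
    by rewrite [RHS](reindex_inj (@perm_inj _ phi)).
  have E : \sum_(d : dart G) 1 = \sum_d (mono d + mono (phi d) + mono (phi (phi d))).
    by apply: eq_bigr => d _; rewrite one.
  rewrite sum_nat_const muln1 !big_split /= (re (fun d => mono (phi d))) re in E.
  by rewrite E !mulSn mul0n addn0 addnA.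
have cardV : #|S| + #|T| = #|verts G|.
  by rewrite -STE cardsU (disjoint_setI0 ST) cards0 subn0.
have [leS connS] := acyclic_on_count (adj_sym G) (@adj_irr _ G) acS S0.
have [leT connT] := acyclic_on_count (adj_sym G) (@adj_irr _ G) acT T0.
(* With [m] inner darts and [f] faces, [3 m = 2 |E| = 3 f], so Euler's formula reads
   [m + 4 = 2 |V|]. This is the sum of the upper bounds for the two forests, hence equality holds in
   both. *)
have total : \sum_(x in S) #|nbrs (adj G) S x| +
    \sum_(x in T) #|nbrs (adj G) T x| + 4 = 2 * #|verts G|.
  case: emb => _ _; rewrite -!card_inner_darts -mono_sum.
  move: mono3; rewrite card_darts_faces; have := card_darts_faces.
  rewrite card_darts; move: (\sum_d mono d) #|porbits phi| => m f.
  by clear; lia.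
have tree A : A \subset verts G -> A != set0 -> acyclic_on (adj G) A ->
    {in A &, forall x y, connect (rel_on (adj G) A) x y} ->
    is_tree (induced G A).
  move=> sAV A0 acA connA; split.
    split=> [|x y]; first by rewrite /= (setIidPr sAV).
    rewrite /= !(setIidPr sAV) => xA yA; rewrite (eq_connect (e' := rel_on (adj G) A)).
      exact: connA.
    by move=> t t'; rewrite adj_induced.
  move=> c; apply/negP => /and3P[lt2c Uc cyc].
  have cA : {subset c <= A}.
    by move=> x xc; have := next_cycle cyc xc; rewrite adj_induced => /andP[].
  have : path.cycle (adj G) c.
    by apply: sub_cycle cyc => x y; rewrite adj_induced => /and3P[].
  by move/(acyclic_on_cycle (adj_sym G) acA cA Uc); rewrite leqNgt lt2c.
split=> //; apply: tree => //.
- by rewrite -STE subsetUl.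
- by apply: connS; move: leS leT cardV total; clear; lia.
- by rewrite -STE subsetUr.
- by apply: connT; move: leS leT cardV total; clear; lia.
Qed.

End ForestsAreTrees.

(** * Extending a partial partition *)

Lemma acyclic_cover_exists (X : finType) (e : rel X) (V S0 T0 : {set X}) :
  S0 :|: T0 \subset V -> [disjoint S0 & T0] ->
  acyclic_on e S0 -> acyclic_on e T0 ->
  (forall (S T : {set X}) u, S0 \subset S -> T0 \subset T -> [disjoint S & T] ->
     acyclic_on e S -> acyclic_on e T -> u \in V -> u \notin S -> u \notin T ->
     acyclic_on e (u |: S) \/ acyclic_on e (u |: T)) ->
  exists S T : {set X}, [/\ S0 \subset S, T0 \subset T, S :|: T = V, [disjoint S & T] &
    acyclic_on e S /\ acyclic_on e T].
Proof.
have [n] := ubnP #|V :\: (S0 :|: T0)|.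
elim: n S0 T0 => // n IHn S0 T0 ltn sV ST0 acS acT ext.
have [full | [u uV]] := set_0Vmem (V :\: (S0 :|: T0)).
  exists S0, T0; split=> //; apply/eqP; rewrite eqEsubset sV /=.
  by rewrite -setD_eq0 full.
have [uV' uST] := setDP uV.
have /norP[uS uT] : ~~ ((u \in S0) || (u \in T0)) by rewrite -in_setU.
have grow (S1 T1 : {set X}) : S0 \subset S1 -> T0 \subset T1 -> S1 :|: T1 = u |: (S0 :|: T0) ->
    [disjoint S1 & T1] -> acyclic_on e S1 -> acyclic_on e T1 ->
    exists S T : {set X}, [/\ S0 \subset S, T0 \subset T, S :|: T = V, [disjoint S & T] &
      acyclic_on e S /\ acyclic_on e T].
  move=> sS sT E ST1 acS1 acT1.
  have [||S T u' sS' sT'|S [T [sS' sT' VE disj ac]]] := IHn S1 T1 _ _ ST1 acS1 acT1.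
  - rewrite E -ltnS; apply: leq_trans ltn; rewrite ltnS; apply: proper_card.
    rewrite properE setDS ?subsetUr //; apply/subsetPn; exists u => //.
    by rewrite !inE eqxx.
  - by rewrite E subUset sub1set uV'.
  - by apply: ext; [apply: subset_trans sS' | apply: subset_trans sT'].
  exists S, T; split=> //; [exact: subset_trans sS' | exact: subset_trans sT'].
have [acSu | acTu] := ext S0 T0 u (subxx _) (subxx _) ST0 acS acT uV' uS uT.
- apply: (grow (u |: S0) T0) => //; first exact: subsetUr.
    by rewrite setUA.
  by rewrite -setI_eq0 setIUl (disjoint_setI0 ST0) setU0 setI_eq0 disjoints1.
- apply: (grow S0 (u |: T0)) => //; first exact: subsetUr.
    by rewrite setUCA.
  by rewrite -setI_eq0 setIUr (disjoint_setI0 ST0) setU0 setI_eq0 disjoint_sym disjoints1.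
Qed.

(** * Placing the vertices of degree 4 *)

Section Partition.
Variables (X : finType) (G : graph X) (s : {perm dart G}).
Hypothesis tri : plane_triangulation s.
Hypothesis ge4 : 4 <= #|verts G|.
Hypothesis even_deg : {in verts G, forall x, ~~ odd (deg G x)}.
Local Notation turn := (turn s).
Implicit Types (x y z u p : X) (A C S T : {set X}).

Let emb : plane_embedding s := proj1 tri.

Lemma add_small S T u a : [disjoint S & T] ->
  acyclic_on (adj G) S -> acyclic_on (adj G) T -> u \notin S -> u \notin T ->
  adj G u a -> deg G u < 6 -> a \in S -> turn u (turn u a) \in S ->
  acyclic_on (adj G) (u |: S) \/ acyclic_on (adj G) (u |: T).
Proof.
move=> ST acS acT uS uT ua small aS cS.
have [_ nbr Uabcd] := small_nbrs tri ge4 even_deg ua small.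
have ub := turn_adj emb ua; have uc := turn_adj emb ub.
have ud := turn_adj emb uc.
pose b := turn u a; pose c := turn u b; pose d := turn u c.
rewrite -/b -/c -/d in nbr Uabcd ub uc ud cS.
have notT x : x \in S -> x \in T = false by move=> xS; rewrite (disjointFr ST).
have nac : a != c by move: Uabcd; rewrite /= !inE !negb_or => /andP[/and3P[_ ->]].
have only_bd x : adj G u x -> x \in T -> (x == b) || (x == d).
  move=> ux xT; have := nbr x ux; rewrite !inE.
  case/or4P => [/eqP Ex|->//|/eqP Ex|->]; rewrite ?orbT //.
    by rewrite Ex notT in xT.
  by rewrite Ex notT in xT.
(* Unless both [b] and [d] lie in [T], [u] has at most one neighbour there and is harmless in
   [T]. *)
have [/andP[bT dT] | nbd] := boolP ((b \in T) && (d \in T)); last first.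
  right; apply: (acyclic_on_add (adj_sym G) (@adj_irr _ G)) => // x y xT yT ux uy nxy.
  case/negP: nbd; case/orP: (only_bd x ux xT) (only_bd y uy yT) => /eqP Ex /orP[] /eqP Ey;
    by move: xT yT nxy; rewrite Ex Ey ?eqxx // => -> ->.
have only_ac x : adj G u x -> x \in S -> (x == a) || (x == c).
  move=> ux xS; have := nbr x ux; rewrite !inE.
  case/or4P => [->//|/eqP Ex|->|/eqP Ex]; rewrite ?orbT //.
    by move: bT; rewrite -Ex notT.
  by move: dT; rewrite -Ex notT.
have [conS | nconS] := boolP (connect (rel_on (adj G) S) a c); last first.
  left; apply: (acyclic_on_add (adj_sym G) (@adj_irr _ G)) => // x y xS yS ux uy nxy.
  have symS := sym_connect_sym (rel_on_sym (adj_sym G) S).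
  case/orP: (only_ac x ux xS) (only_ac y uy yS) => /eqP Ex /orP[] /eqP Ey;
    by move: nxy; rewrite Ex Ey ?eqxx // symS.
right; apply: (acyclic_on_add (adj_sym G) (@adj_irr _ G)) => // x y xT yT ux uy nxy.
have ncon : ~~ connect (rel_on (adj G) T) b d.
  apply/negP => conT.
  exact: (crossing emb uS uT ST ua ub aS cS nac bT dT conS conT).
have symT := sym_connect_sym (rel_on_sym (adj_sym G) T).
case/orP: (only_bd x ux xT) (only_bd y uy yT) => /eqP Ex /orP[] /eqP Ey;
  by move: nxy; rewrite Ex Ey ?eqxx // symT.
Qed.

Variables V3 : {set X}.
Hypothesis ind3 : independent G V3.

Let h : rel X := fun x y => adj G x y && ((x \in V3) != (y \in V3)).

Definition fits C u := [forall p in V3, adj G u p ==> (p \in C)].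

(** A vertex of degree 4 that fails to fit has at most one neighbour in [C], since two would be all
    its neighbours in [V3]. As [V] is independent, it has no other neighbour in the set and is a
    leaf. *)
Lemma acyclic_side V U C : independent G V -> [disjoint V & V3] ->
  C \subset V3 -> acyclic_on h (V :&: U :|: C) ->
  acyclic_on (adj G)
    (V :&: U :|: C :|: [set u in V | (deg G u < 6) && ~~ fits C u]).
Proof.
move=> indV VV3 sC acC B sB degB.
have inB x : x \in B -> (x \in V) || (x \in C).
  by move/(subsetP sB); rewrite !inE => /orP[/orP[/andP[->]|->]|/andP[->]]; rewrite ?orbT.
have adjC x y : x \in B -> y \in B -> adj G x y -> x \in V -> y \in C.
  move=> xB yB xy xV; case/orP: (inB y yB) => // yV.
  by have := indV x y xV yV; rewrite xy.
apply: acC => [|x xB].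
  apply/subsetP => u uB; have := subsetP sB u uB; rewrite [in X in X -> _]inE.
  case/orP => // ; rewrite inE => /and3P[uV small] /negP[].
  have /card_gt1P[y [y' [yN yN' nyy']]] := degB u uB.
  have /andP[yB uy] : (y \in B) && adj G u y by rewrite inE in yN.
  have /andP[yB' uy'] : (y' \in B) && adj G u y' by rewrite inE in yN'.
  have [yC yC'] := (adjC u y uB yB uy uV, adjC u y' uB yB' uy' uV).
  have uV3 : u \notin V3 by rewrite (disjointFr VV3).
  have [y3 y3'] := (subsetP sC y yC, subsetP sC y' yC').
  apply/forall_inP => p p3; apply/implyP => up.
  have [<- // | nyp] := eqVneq y p.
  have other := small_V3_nbr tri ge4 even_deg ind3 uV3 small uy.
  by rewrite (other p) // -(other y').
apply: leq_trans (degB x xB) _; apply/subset_leq_card/subsetP => y.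
rewrite !inE => /andP[yB xy]; rewrite yB /h xy /=.
case/orP: (inB x xB) => [xV | xC].
  by rewrite (disjointFr VV3 xV) (subsetP sC) // (adjC x y).
have x3 := subsetP sC x xC; rewrite x3.
by apply: contraL xy => /eqP y3; apply: ind3.
Qed.

End Partition.

(** * The partition *)

Section Main.
Variables (X : finType) (G : graph X) (s : {perm dart G}) (V1 V2 V3 : {set X}).
Hypothesis even_tri : even_plane_triangulation s.
Hypotheses (VE : V1 :|: V2 :|: V3 = verts G).
Hypotheses (V12 : [disjoint V1 & V2]) (V13 : [disjoint V1 & V3]).
Hypotheses (V23 : [disjoint V2 & V3]).
Hypotheses (ind1 : independent G V1) (ind2 : independent G V2).
Hypothesis ind3 : independent G V3.
Implicit Types (x y z u p : X) (A C S T : {set X}).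
Local Notation turn := (turn s).

Let tri : plane_triangulation s. Proof. by case: even_tri. Qed.
Let ge4 : 4 <= #|verts G|. Proof. by case: even_tri. Qed.
Let even_deg : {in verts G, forall x, ~~ odd (deg G x)}.
Proof. by case: even_tri. Qed.
Let emb : plane_embedding s := proj1 tri.

Let h : rel X := fun x y => adj G x y && ((x \in V3) != (y \in V3)).
Let B1 := big_in G V1.
Let B2 := big_in G V2.
Let B3 := big_in G V3.

Lemma adj_class x y : adj G x y -> [/\ x \in V1 -> y \notin V1,
  x \in V2 -> y \notin V2 & x \in V3 -> y \notin V3].
Proof.
move=> xy; split=> xV; apply: contraL xy => yV.
- exact: ind1.
- exact: ind2.
- exact: ind3.
Qed.

Lemma vert_class x : x \in verts G -> [|| x \in V1, x \in V2 | x \in V3].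
Proof. by rewrite -VE !inE orbA. Qed.

Lemma class_disj x : [/\ x \in V1 -> (x \in V2 = false) * (x \in V3 = false),
  x \in V2 -> (x \in V1 = false) * (x \in V3 = false) &
  x \in V3 -> (x \in V1 = false) * (x \in V2 = false)].
Proof.
split=> xV.
- by rewrite (disjointFr V12) // (disjointFr V13).
- by rewrite (disjointFl V12) // (disjointFr V23).
- by rewrite (disjointFl V13) // (disjointFl V23).
Qed.

Definition colour x := if x \in V1 then 0 else if x \in V2 then 1 else 2.

Lemma colour1 x : (colour x == 0) = (x \in V1).
Proof. by rewrite /colour; case: ifP => // _; case: ifP. Qed.

Lemma colour2 x : (colour x == 1) = (x \in V2).
Proof.
rewrite /colour; case: ifPn => [xV | _]; last by case: ifP.
by have [/(_ xV)[-> _]] := class_disj x.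
Qed.

Lemma colour3 x : x \in verts G -> (colour x == 2) = (x \in V3).
Proof.
move=> xV; have := vert_class xV; have [c1 c2 _] := class_disj x; rewrite /colour.
case: ifPn => [/c1[_ ->] // | _]; case: ifPn => [/c2[_ ->] // | _].
by move=> /= ->.
Qed.

Lemma colour_lt3 x : colour x < 3.
Proof. by rewrite /colour; case: ifP => // _; case: ifP. Qed.

Lemma colour_adj x y : adj G x y -> colour x != colour y.
Proof.
move=> xy; have xV := adj_verts xy; have [a1 a2 a3] := adj_class xy.
have yV : y \in verts G by apply: (@adj_verts _ _ _ x); rewrite adj_sym.
apply/eqP => E; have := vert_class xV; rewrite -!colour1 -!colour2 -!colour3 // in a1 a2 a3 *.
by rewrite -E in a1 a2 a3; case/or3P => H; [have := a1 H | have := a2 H | have := a3 H]; rewrite H.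
Qed.

(** Consecutive neighbours of [u] are adjacent, so the two colours different from that of [u]
    alternate around it. *)
Lemma colour_opposite u a : adj G u a -> colour (turn u (turn u a)) = colour a.
Proof.
move=> ua; have ub := turn_adj emb ua; have uc := turn_adj emb ub.
have := colour_adj ua; have := colour_adj ub; have := colour_adj uc.
have := colour_adj (turn_tri_adj tri ua); have := colour_adj (turn_tri_adj tri ub).
have := colour_lt3 u; have := colour_lt3 a; have := colour_lt3 (turn u a).
have := colour_lt3 (turn u (turn u a)).
move: (colour _) (colour u) (colour a) (colour _) => x1 x2 x3 x4; clear; lia.
Qed.

Lemma nbr_of_colour u i : u \in verts G -> i < 3 -> i != colour u ->
  exists2 a, adj G u a & colour a = i.
Proof.
move=> uV i3 iu; have [a ua] : exists a, adj G u a.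
  have := deg_gt0 tri ge4 uV; rewrite card_gt0 => /set0Pn[a].
  by rewrite inE; exists a.
have ub := turn_adj emb ua.
have [<- | ia] := eqVneq (colour a) i; first by exists a.
exists (turn u a) => //.
have := colour_adj ua; have := colour_adj ub.
have := colour_adj (turn_tri_adj tri ua).
have := colour_lt3 u; have := colour_lt3 a; have := colour_lt3 (turn u a).
move: i3 iu ia; move: (colour (turn u a)) (colour u) (colour a) => x1 x2 x3; clear; lia.
Qed.

Hypothesis cyc : cycles_0mod4
  (gunion (induced G (B1 :|: B3)) (induced G (B2 :|: B3))).
Variables v w : X.
Hypotheses (vw : adj G v w) (vB3 : v \in B3) (wV1 : w \in V1).

Lemma good_B3_colouring_exists : exists C, [/\ C \subset B3, v \in C,
  acyclic_on h (V1 :&: (w |: (B1 :|: B2 :|: B3)) :|: C) &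
  acyclic_on h (V2 :&: (w |: (B1 :|: B2 :|: B3)) :|: (B3 :\: C))].
Proof.
set U := w |: _.
have vV3 : v \in V3 by move: vB3; rewrite inE => /andP[].
have h_sym : symmetric h by move=> x y; rewrite /h adj_sym eq_sym.
have h_bip x y : h x y -> (x \in V3) != (y \in V3) by case/andP.
have wV3 : w \notin V3 by case: (class_disj w) => /(_ wV1)[_ ->].
have U3 : V3 :&: U = B3.
  apply/setP => x; rewrite !inE; have [xV|] := boolP (x \in V3) => //=.
  have [_ _ /(_ xV)[-> ->]] := class_disj x; rewrite /=.
  by case: eqP => // xw; rewrite xw (negbTE wV3) in xV.
have finish (K : {set X}) q : #|K| <= 1 -> K \subset V1 ->
    (forall k p, k \in K -> h k p -> p = v \/ p = q) -> q != v ->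
    {subset U :\: K <= B1 :|: B2 :|: B3} ->
    common_nbrs h V3 K v q U ->
    exists C, [/\ C \subset B3, v \in C, acyclic_on h (V1 :&: U :|: C) &
      acyclic_on h (V2 :&: U :|: (B3 :\: C))].
  move=> K1 KV1 nbrK qv UK comm.
  have V31 : [disjoint V3 & V1] by rewrite disjoint_sym.
  have V32 : [disjoint V3 & V2] by rewrite disjoint_sym.
  have [|||C [sC vC ac1 ac2]] :=
    @good_colouring_exists X h V3 V1 V2 K v q h_sym h_bip V31 V32 V12 K1 KV1 nbrK vV3 qv U _ _ _ comm.
  - apply/subsetP => x; rewrite !inE.
    by case/orP => [/eqP-> | /orP[/orP[]|] /andP[-> _]]; rewrite ?wV1 ?orbT.
  - by rewrite in_setU1 in_setU vB3 !orbT.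
  - move=> c sc Uc cyc_c lt2c; apply/eqP; apply: cyc; rewrite /graph_cycle lt2c Uc /=.
    apply: (sub_in_cycle (P := mem c)) cyc_c; last by apply/allP.
    move=> x y xc yc /andP[xy bip].
    have xU := UK x (sc x xc); have yU := UK y (sc y yc).
    have adjU A : x \in A -> y \in A -> [set x; y] \in edges (induced G A).
      by move=> xA yA; rewrite /= inE subUset !sub1set xA yA !andbT.
    have notV3 t : t \in B1 :|: B2 -> t \in V3 = false.
      have [t1 t2 _] := class_disj t.
      by rewrite !inE => /orP[] /andP[tV _]; [case: (t1 tV) | case: (t2 tV)].
    rewrite /adj in_setU; case/setUP: xU => xB; case/setUP: yU => yB.
    + by rewrite !notV3 in bip.
    + apply/orP; case/setUP: xB => xB; [left | right]; apply: adjU;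
        by rewrite in_setU ?xB ?yB ?orbT.
    + apply/orP; case/setUP: yB => yB; [left | right]; apply: adjU;
        by rewrite in_setU ?xB ?yB ?orbT.
    + by apply/orP; left; apply: adjU; rewrite in_setU ?xB ?yB orbT.
  by exists C; rewrite -U3.
have [wbig | wsmall] := leqP 6 (deg G w).
  (* The second argument is a dummy: since [w] is not in [V3], the condition on common neighbours is
     vacuous. *)
  apply: (finish set0 w); rewrite ?cards0 ?sub0set //.
  - by move=> k p; rewrite inE.
  - by apply: contraNneq wV3 => ->.
  - move=> x; rewrite setD0 => /setU1P[-> | //].
    by rewrite !inE wV1 wbig.
  - by move=> _ _ wV; rewrite wV in wV3.
(* Here [w] lies outside the graph of the cycle hypothesis and goes into [K]. By independence of
   [V3], no neighbour of [w] in [V3] other than [v] is possible except the opposite one, [q]. *)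
pose q := turn w (turn w v).
have wv : adj G w v by rewrite adj_sym.
have [_ nbr Uq] := small_nbrs tri ge4 even_deg wv wsmall.
have vq : v != q by move: Uq; rewrite /= !inE !negb_or => /andP[/and3P[_ ->]].
have wq : adj G w q by rewrite !turn_adj.
have nbr3 p : h w p -> p = v \/ p = q.
  case/andP => wp bip.
  have pV : p \in V3 by move: bip; rewrite (negbTE wV3); case: (p \in V3).
  have [-> | nvp] := eqVneq v p; first by left.
  by right; apply: (small_V3_nbr tri ge4 even_deg ind3 wV3 wsmall wv wp vV3 pV nvp).
have UK : {subset U :\: [set w] <= B1 :|: B2 :|: B3}.
  by move=> x; rewrite in_setD1 => /andP[xw /setU1P[xw' | //]]; rewrite xw' eqxx in xw.
apply: (finish [set w] q) => //.
- by rewrite cards1.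
- by rewrite sub1set.
- by move=> k p /set1P ->; apply: nbr3.
- by rewrite eq_sym.
move=> [x xU hvx] qU qV3.
have xbig : 6 <= deg G x.
  by have := UK x xU; rewrite !inE => /orP[/orP[]|] /andP[].
have vx : adj G v x by case/andP: hvx.
have qw : adj G q w by rewrite adj_sym.
have [y [y' [ybig ybig' nyy' /andP[vy vy'] /andP[qy qy']]]] :=
  big_common tri ge4 even_deg ind3 vV3 qV3 vq wV3 wsmall vw qw vx xbig.
have inU t : 6 <= deg G t -> adj G v t ->
    [/\ t \in U :\: [set w], h v t & adj G q t -> h q t].
  move=> tbig vt; have [_ _ /(_ vV3) tV3] := adj_class vt.
  have tV := vert_class (adj_verts (etrans (adj_sym G t v) vt)).
  rewrite /h vV3 qV3 (negbTE tV3) vt; split=> // [|->//].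
  rewrite in_setD1; apply/andP; split.
    by apply: contraTneq tbig => ->; rewrite -ltnNge.
  by move: tV; rewrite (negbTE tV3) orbF !inE tbig !andbT => /orP[]->; rewrite ?orbT.
have [yU hvy /(_ qy) hqy] := inU y ybig vy.
have [yU' hvy' /(_ qy') hqy'] := inU y' ybig' vy'.
by exists y, y'; rewrite hvy hvy' hqy hqy'.
Qed.

Lemma partition_V1 : exists S T, [/\ tree_bipartition G S T,
  B1 \subset S, B2 \subset T, v \in S & w \in S].
Proof.
have [C [sC vC ac1 ac2]] := good_B3_colouring_exists.
set U := w |: _ in ac1 ac2.
have vV3 : v \in V3 by move: vB3; rewrite inE => /andP[].
have sB3 : B3 \subset V3 by apply/subsetP => x; rewrite inE => /andP[].
have sC3 : C \subset V3 := subset_trans sC sB3.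
have sC3' : B3 :\: C \subset V3 := subset_trans (subsetDl _ _) sB3.
have acS := acyclic_side tri ge4 even_deg ind3 ind1 V13 sC3 ac1.
have acT := acyclic_side tri ge4 even_deg ind3 ind2 V23 sC3' ac2.
set S0 := _ :|: _ in acS; set T0 := _ :|: _ in acT.
have S0E x : x \in S0 = (x \in C) || (x \in V1) &&
    [|| 6 <= deg G x, x == w | ~~ fits G V3 C x].
  rewrite /S0 !in_setU in_setI in_setU1 !in_setU !inE [_ < 6]ltnNge.
  have [/= xV | _] := boolP (x \in V1); last by rewrite /= orbF.
  have [/(_ xV)[-> ->] _ _] := class_disj x.
  by case: (6 <= _); case: (x == w); case: (x \in C); case: (fits G V3 C x).
have T0E x : x \in T0 = (x \in B3 :\: C) || (x \in V2) &&
    ((6 <= deg G x) || ~~ fits G V3 (B3 :\: C) x).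
  rewrite /T0 in_setU [x \in _ :|: _]in_setU in_setI in_setU1 !in_setU.
  rewrite [x \in B1]inE [x \in B2]inE [in x \in B3]inE [x \in [set _ in _ | _]]inE [_ < 6]ltnNge.
  have [/= xV | _] := boolP (x \in V2); last by rewrite /= orbF.
  have [_ /(_ xV)[-> ->] _] := class_disj x.
  have -> : (x == w) = false.
    by apply: contraTF xV => /eqP->; have [/(_ wV1)[-> _]] := class_disj w.
  by case: (6 <= _); case: (x \in _ :\: _); case: (fits G V3 (B3 :\: C) x).
have ST0 : [disjoint S0 & T0].
  rewrite -setI_eq0; apply/eqP/setP => x; rewrite in_setI in_set0 S0E T0E in_setD.
  have [c1 c2 c3] := class_disj x.
  apply/negP => /andP[/orP[xC | /andP[/c1[x2 x3] _]]].
    by have [_ ->] := c3 (subsetP sC3 x xC); rewrite xC.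
  by rewrite x2 orbF => /andP[_ /(subsetP sB3)]; rewrite x3.
have STV : S0 :|: T0 \subset verts G.
  apply/subsetP => x; rewrite -VE in_setU S0E T0E !in_setU.
  case/orP => /orP[xC | /andP[-> _]]; rewrite ?orbT //.
    by rewrite (subsetP sC3) ?orbT.
  by rewrite (subsetP sC3') ?orbT.
have [S [T [sS sT STE ST [acS' acT']]]] :
    exists S T, [/\ S0 \subset S, T0 \subset T, S :|: T = verts G, [disjoint S & T] &
    acyclic_on (adj G) S /\ acyclic_on (adj G) T].
  apply: (acyclic_cover_exists STV ST0 acS acT) => S T u sS sT ST acS' acT' uV uS uT.
  have uS0 : u \notin S0 by apply: contra uS; apply: subsetP.
  have uT0 : u \notin T0 by apply: contra uT; apply: subsetP.
  have small : deg G u < 6.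
    rewrite ltnNge; apply/negP => big; move: uS0 uT0.
    rewrite S0E T0E in_setD [u \in B3]inE big /= !andbT.
    by have := vert_class uV; case: (u \in C); case/or3P => ->; rewrite ?orbT.
  have fitsP A p : fits G V3 A u -> adj G u p -> p \in V3 -> p \in A.
    by move=> /forall_inP fit up pV; apply: (implyP (fit p pV)).
  have adjV x : adj G u x -> x \in verts G.
    by move=> ux; apply: (@adj_verts _ _ _ u); rewrite adj_sym.
  have opp a : adj G u a -> adj G u (turn u (turn u a)).
    by move=> ua; apply: (turn_adj emb (turn_adj emb ua)).
  have oppV3 a : adj G u a -> a \in V3 -> turn u (turn u a) \in V3.
    move=> ua; rewrite -!colour3 ?adjV //; last exact: opp.
    by rewrite colour_opposite.
  case/or3P: (vert_class uV) => uVi.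
  - have [|a ua /eqP] := nbr_of_colour (i := 2) uV isT.
      by rewrite /colour uVi.
    rewrite colour3 ?adjV // => aV.
    have fit : fits G V3 C u by move: uS0; rewrite S0E uVi !negb_or negbK => /and4P[].
    have inS p : adj G u p -> p \in V3 -> p \in S.
      by move=> up pV; apply: (subsetP sS); rewrite S0E (fitsP C).
    apply: (add_small tri ge4 even_deg ST acS' acT' uS uT ua small).
      exact: inS.
    by apply: inS; [apply: opp | apply: oppV3].
  - have [|a ua /eqP] := nbr_of_colour (i := 2) uV isT.
      by rewrite /colour uVi; case: ifP.
    rewrite colour3 ?adjV // => aV.
    have fit : fits G V3 (B3 :\: C) u.
      by move: uT0; rewrite T0E uVi !negb_or negbK => /and3P[].
    have inT p : adj G u p -> p \in V3 -> p \in T.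
      by move=> up pV; apply: (subsetP sT); rewrite T0E (fitsP (B3 :\: C)).
    have TS : [disjoint T & S] by rewrite disjoint_sym.
    have aT := inT a ua aV; have cT := inT _ (opp a ua) (oppV3 a ua aV).
    have [] := add_small tri ge4 even_deg TS acT' acS' uT uS ua small aT cT.
      by right.
    by left.
  - have [|a ua /eqP] := nbr_of_colour (i := 0) uV isT.
      by rewrite -colour3 // in uVi; rewrite (eqP uVi).
    rewrite colour1 => aV.
    (* As [u] is not big, it is outside [C]; so its neighbours in [V1] do not fit [C] and were all
       put into [S0]. *)
    have uC : u \notin C.
      by apply: contraL small => /(subsetP sC); rewrite inE -leqNgt => /andP[].
    have inS p : adj G u p -> p \in V1 -> p \in S.
      move=> up pV; apply: (subsetP sS); rewrite S0E pV.
      suff -> : ~~ fits G V3 C p by rewrite !orbT.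
      apply/forall_inPn; exists u => //.
      by rewrite adj_sym up.
    apply: (add_small tri ge4 even_deg ST acS' acT' uS uT ua small).
      exact: inS.
    by apply: inS; [apply: opp | rewrite -colour1 colour_opposite // colour1].
have wS : w \in S by apply: (subsetP sS); rewrite S0E wV1 eqxx !orbT.
have vS : v \in S by apply: (subsetP sS); rewrite S0E vC.
exists S, T; split=> //.
- apply: (forests_trees tri) => //; first by apply/set0Pn; exists v.
  (* With [T] empty, a face at the edge [vw] would be a triangle inside the forest [S]. *)
  apply/negP => /eqP T0E'.
  have SV : S = verts G by rewrite -STE T0E' setU0.
  have vz := turn_adj emb vw; have zw := turn_tri_adj tri vw.
  apply: (acyclic_triangle_free acS' vS wS _ vw _ vz); last by rewrite adj_sym.
  by rewrite SV; apply: adj_verts zw.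
- apply: subset_trans sS; apply/subsetP => x; rewrite inE S0E => /andP[-> ->].
  by rewrite orbT.
- apply: subset_trans sT; apply/subsetP => x; rewrite inE T0E => /andP[-> ->].
  by rewrite orbT.
Qed.

End Main.

Lemma partition3P (X : finType) (G : graph X) (V1 V2 V3 : {set X}) :
  vertex_3partition G V1 V2 V3 ->
  [/\ V1 :|: V2 :|: V3 = verts G, [disjoint V1 & V2], [disjoint V1 & V3] &
    [disjoint V2 & V3]].
Proof.
case; rewrite /= !inE negb_or => /and3P[/andP[n12 n13] n23 _].
case/and3P => /eqP cov /trivIsetP triv _ _ _ _; split.
- rewrite -cov /cover; apply/setP => x; apply/idP/bigcupP.
    rewrite !inE => /orP[/orP[]|] xV; [exists V1 | exists V2 | exists V3] => //;
      by rewrite !inE eqxx ?orbT.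
  by case=> V; rewrite !inE => /orP[/orP[]|] /eqP-> ->; rewrite ?orbT.
- by apply: triv; rewrite // !inE eqxx ?orbT.
- by apply: triv; rewrite // !inE eqxx ?orbT.
- by apply: triv; rewrite // !inE eqxx ?orbT.
Qed.

Lemma cycles_0mod4_gunionC (X : finType) (G H : graph X) :
  cycles_0mod4 (gunion G H) -> cycles_0mod4 (gunion H G).
Proof.
move=> cyc c /and3P[lt2c Uc cycc]; apply: cyc; rewrite /graph_cycle lt2c Uc /=.
by apply: sub_cycle cycc => x y; rewrite /adj !in_setU orbC.
Qed.

Theorem theorem3 (X : finType) (G : graph X) (s : {perm dart G})
    (V1 V2 V3 : {set X}) (v w : X) :
  even_plane_triangulation s ->
  vertex_3partition G V1 V2 V3 ->
  let B1 := big_in G V1 in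
  let B2 := big_in G V2 in
  let B3 := big_in G V3 in
  cycles_0mod4 (gunion (induced G (B1 :|: B3)) (induced G (B2 :|: B3))) ->
  adj G v w -> v \in B3 ->
  (w \in V1 ->
     exists S T : {set X},
       [/\ tree_bipartition G S T, B1 \subset S, B2 \subset T, v \in S & w \in S])
  /\
  (w \in V2 ->
     exists S T : {set X},
       [/\ tree_bipartition G S T, B1 \subset S, B2 \subset T, v \in T & w \in T]).
Proof.
move=> even_tri part B1 B2 B3 cyc vw vB3.
have [VE V12 V13 V23] := partition3P part; case: part => _ _ ind1 ind2 ind3.
split=> wV.
  exact: (partition_V1 even_tri VE V12 V13 V23 ind1 ind2 ind3 cyc vw vB3 wV).
(* The situation is symmetric in [V1] and [V2]; exchanging them exchanges [S] and [T]. *)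
have VE' : V2 :|: V1 :|: V3 = verts G by rewrite (setUC V2).
have V21 : [disjoint V2 & V1] by rewrite disjoint_sym.
have [S [T [[STE ST treeS treeT] sS sT vS wS]]] :=
  partition_V1 even_tri VE' V21 V23 V13 ind2 ind1 ind3
    (cycles_0mod4_gunionC cyc) vw vB3 wV.
by exists T, S; split=> //; split; rewrite // 1?setUC 1?disjoint_sym.
Qed.
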